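(* Let $R$ be a commutative ring whose total quotient ring $Q$ is self FP-injective (i.e. $Q$ is FP-injective as a $Q$-module). Then each flat $R$-module is finitely projective if and only if $Q$ is a perfect ring.
   Context: The total quotient ring $Q$ of a commutative ring $R$ is the localization of $R$ at the multiplicative set of its non-zero-divisors. An $R$-module $M$ is finitely projective if, for any finitely generated submodule $N$ of $M$, the inclusion map $N\to M$ factors through a free module. A module $M$ is FP-injective if, for any finitely generated submodule $A$ of a finitely presented module $B$, each homomorphism $A\to M$ extends to $B$. A commutative ring is perfect if each flat module over it is projective. *)

(* Defs.v *)
From HB Require Import structures.
From mathcomp Require Import all_boot all_algebra ring.
From mathcomp Require Import boolp classical_sets functions cardinality fsbigop.

Set Implicit Arguments.
Unset Strict Implicit.
Unset Printing Implicit Defensive.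

Import GRing.Theory.
Local Open Scope classical_set_scope.
Local Open Scope quotient_scope.
Local Open Scope ring_scope.

(* Rings are [comPzRingType]s, so that the zero ring is allowed; modules over
   R are [lmodType R]s and submodules are [subLmodType]s. *)

Section Localization.
Variables (R : comPzRingType) (S : mulrClosed R).

Definition loc_den := {s : R | s \in S}.

Lemma loc_denM_subproof (s t : loc_den) : val s * val t \in S.
Proof. by rewrite rpredM ?(valP s) ?(valP t). Qed.

Definition loc_den1 : loc_den := exist _ 1 (@rpred1 R S).
Definition loc_denM (s t : loc_den) : loc_den := exist _ (val s * val t) (loc_denM_subproof s t).

Definition loc_equiv (x y : R * loc_den) : bool :=
  `[< exists2 u, u \in S & u * (x.1 * val y.2) = u * (y.1 * val x.2) >].

Lemma loc_equiv_refl : reflexive loc_equiv.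
Proof. by move=> x; apply/asboolP; exists 1; rewrite ?rpred1. Qed.

Lemma loc_equiv_sym : symmetric loc_equiv.
Proof.
by move=> x y; apply/asboolP/asboolP => -[u uS e]; exists u.
Qed.

Lemma loc_equiv_trans : transitive loc_equiv.
Proof.
move=> y x z /asboolP[u uS e] /asboolP[v vS e']; apply/asboolP.
exists (u * v * val y.2); first by rewrite !rpredM // (valP y.2).
transitivity (v * val z.2 * (u * (x.1 * val y.2))); first by ring.
rewrite e; transitivity (u * val x.2 * (v * (y.1 * val z.2))); first by ring.
by rewrite e'; ring.
Qed.

Canonical loc_equivRel := EquivRel loc_equiv loc_equiv_refl loc_equiv_sym loc_equiv_trans.

Definition localization := {eq_quot loc_equiv}.
HB.instance Definition _ : EqQuotient _ loc_equiv localization := EqQuotient.on localization.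
HB.instance Definition _ := Choice.on localization.

Definition loc_frac (a : R) (s : loc_den) : localization := \pi_localization (a, s).

Lemma loc_fracP (q : localization) : exists a s, q = loc_frac a s.
Proof. by exists (repr q).1, (repr q).2; rewrite /loc_frac -surjective_pairing reprK. Qed.

Lemma eq_loc_frac a s b t :
  loc_frac a s = loc_frac b t <->
  exists2 u, u \in S & u * (a * val t) = u * (b * val s).
Proof.
split=> [/eqmodP/asboolP//|h]; apply/eqmodP/asboolP; exact: h.
Qed.

Definition loc_add (x y : localization) : localization :=
  loc_frac ((repr x).1 * val (repr y).2 + (repr y).1 * val (repr x).2)
       (loc_denM (repr x).2 (repr y).2).
Definition loc_opp (x : localization) : localization := loc_frac (- (repr x).1) (repr x).2.
Definition loc_mul (x y : localization) : localization :=
  loc_frac ((repr x).1 * (repr y).1) (loc_denM (repr x).2 (repr y).2).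

Lemma repr_loc_frac a s : exists2 u, u \in S &
  u * ((repr (loc_frac a s)).1 * val s) = u * (a * val (repr (loc_frac a s)).2).
Proof. by apply/eq_loc_frac; rewrite /loc_frac -surjective_pairing reprK. Qed.

Lemma loc_addE a s b t :
  loc_add (loc_frac a s) (loc_frac b t) = loc_frac (a * val t + b * val s) (loc_denM s t).
Proof.
rewrite /loc_add; have [u uS eu] := repr_loc_frac a s; have [v vS ev] := repr_loc_frac b t.
case: (repr (loc_frac a s)) eu => a' s' /= eu; case: (repr (loc_frac b t)) ev => b' t' /= ev.
apply/eq_loc_frac; exists (u * v); first exact: rpredM.
move: eu ev; rewrite /=; move: (sval s) (sval t) (sval s') (sval t').
move=> zs zt zs' zt' eu ev.
transitivity (v * zt' * zt * (u * (a' * zs)) + u * zs' * zs * (v * (b' * zt))).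
  by ring.
by rewrite eu ev; ring.
Qed.

Lemma loc_oppE a s : loc_opp (loc_frac a s) = loc_frac (- a) s.
Proof.
rewrite /loc_opp; have [u uS eu] := repr_loc_frac a s.
by apply/eq_loc_frac; exists u; rewrite // !mulNr !mulrN eu.
Qed.

Lemma loc_mulE a s b t : loc_mul (loc_frac a s) (loc_frac b t) = loc_frac (a * b) (loc_denM s t).
Proof.
rewrite /loc_mul; have [u uS eu] := repr_loc_frac a s; have [v vS ev] := repr_loc_frac b t.
case: (repr (loc_frac a s)) eu => a' s' /= eu; case: (repr (loc_frac b t)) ev => b' t' /= ev.
apply/eq_loc_frac; exists (u * v); first exact: rpredM.
transitivity ((u * (a' * val s)) * (v * (b' * val t))); first by rewrite /=; ring.
by rewrite eu ev /=; ring.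
Qed.

Lemma loc_frac_congr a s b t : a * val t = b * val s -> loc_frac a s = loc_frac b t.
Proof. by move=> e; apply/eq_loc_frac; exists 1; rewrite ?rpred1 ?mul1r. Qed.

Lemma loc_addA : associative loc_add.
Proof.
move=> x y z; have [a [s ->]] := loc_fracP x; have [b [t ->]] := loc_fracP y.
have [c [w ->]] := loc_fracP z; rewrite !loc_addE; apply: loc_frac_congr => /=.
by ring.
Qed.

Lemma loc_addC : commutative loc_add.
Proof.
move=> x y; have [a [s ->]] := loc_fracP x; have [b [t ->]] := loc_fracP y.
by rewrite !loc_addE; apply: loc_frac_congr; rewrite /= addrC [val t * _]mulrC.
Qed.

Lemma loc_add0 : left_id (loc_frac 0 loc_den1) loc_add.
Proof.
move=> x; have [a [s ->]] := loc_fracP x.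
by rewrite loc_addE; apply: loc_frac_congr; rewrite /= mul0r add0r mul1r mulr1.
Qed.

Lemma loc_addN : left_inverse (loc_frac 0 loc_den1) loc_opp loc_add.
Proof.
move=> x; have [a [s ->]] := loc_fracP x.
by rewrite loc_oppE loc_addE; apply: loc_frac_congr; rewrite /= mulNr addNr !mul0r.
Qed.

HB.instance Definition _ := GRing.isZmodule.Build localization loc_addA loc_addC loc_add0 loc_addN.

Lemma loc_mulA : associative loc_mul.
Proof.
move=> x y z; have [a [s ->]] := loc_fracP x; have [b [t ->]] := loc_fracP y.
by have [c [w ->]] := loc_fracP z; rewrite !loc_mulE; apply: loc_frac_congr; rewrite /= !mulrA.
Qed.

Lemma loc_mulC : commutative loc_mul.
Proof.
move=> x y; have [a [s ->]] := loc_fracP x; have [b [t ->]] := loc_fracP y.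
by rewrite !loc_mulE; apply: loc_frac_congr; rewrite /= [b * a]mulrC [val t * _]mulrC.
Qed.

Lemma loc_mul1 : left_id (loc_frac 1 loc_den1) loc_mul.
Proof.
move=> x; have [a [s ->]] := loc_fracP x.
by rewrite loc_mulE; apply: loc_frac_congr; rewrite /= !mul1r.
Qed.

Lemma loc_mulDl : left_distributive loc_mul +%R.
Proof.
move=> x y z; rewrite /GRing.add /=.
have [a [s ->]] := loc_fracP x; have [b [t ->]] := loc_fracP y.
have [c [w ->]] := loc_fracP z; rewrite !(loc_addE, loc_mulE); apply: loc_frac_congr => /=.
by ring.
Qed.

HB.instance Definition _ :=
  GRing.Zmodule_isComPzRing.Build localization loc_mulA loc_mulC loc_mul1 loc_mulDl.

End Localization.
Definition non_zero_divisor (R : comPzRingType) : {pred R} :=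
  fun s => `[< forall x : R, s * x = 0 -> x = 0 >].

Lemma non_zero_divisor_closed (R : comPzRingType) :
  mulr_closed (@non_zero_divisor R).
Proof.
split=> [|s t /asboolP sP /asboolP tP]; apply/asboolP => x; first by rewrite mul1r.
by rewrite -mulrA => /sP/tP.
Qed.

HB.instance Definition _ (R : comPzRingType) :=
  GRing.isMulClosed.Build R (@non_zero_divisor R) (non_zero_divisor_closed R).

Definition total_quotient (R : comPzRingType) :=
  localization (@non_zero_divisor R).
HB.instance Definition _ (R : comPzRingType) :=
  GRing.ComPzRing.on (total_quotient R).

Section GeneratedSubmodule.
Variables (R : pzRingType) (V : lmodType R) (G : set V).

Definition gen_submod : {pred V} := fun x =>
  `[< forall W : {pred V}, submod_closed W -> G `<=` [set` W] -> x \in W >].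

Lemma gen_submod_closed : submod_closed gen_submod.
Proof.
split=> [|a x y /asboolP xG /asboolP yG]; apply/asboolP => W Wsub GW.
  by case: Wsub.
by case: (Wsub) => _ Wlin; apply: Wlin; [exact: xG | exact: yG].
Qed.

HB.instance Definition _ :=
  GRing.isSubmodClosed.Build R V gen_submod gen_submod_closed.

Lemma mem_gen_submod x : G x -> x \in gen_submod.
Proof. by move=> Gx; apply/asboolP => W _; apply. Qed.

End GeneratedSubmodule.

Section QuotientModule.
Variables (R : pzRingType) (V : lmodType R) (W : submodClosed V).

(* A [submodClosed V] is not a [zmodClosed V] in the hierarchy. *)
Definition submod_pred : {pred V} := W.

Lemma submod_pred_closed : zmod_closed submod_pred.
Proof. exact/GRing.submod_closedB/GRing.submodClosedP. Qed.

HB.instance Definition _ :=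
  GRing.isZmodClosed.Build V submod_pred submod_pred_closed.

Definition quotmod := Quotient.quot submod_pred.
HB.instance Definition _ := GRing.Zmodule.on quotmod.
HB.instance Definition _ := EqQuotient.on quotmod.

Definition quotmod_pi (x : V) : quotmod := \pi_quotmod x.

Lemma eq_quotmod_pi x y : quotmod_pi x = quotmod_pi y <-> x - y \in W.
Proof.
have -> : (x - y \in W) = (x == y %[mod quotmod]).
  exact: (Quotient.idealrBE submod_pred).
by split=> [/eqP|/eqP].
Qed.

Lemma quotmod_piP (q : quotmod) : exists x, q = quotmod_pi x.
Proof. by exists (repr q); rewrite /quotmod_pi reprK. Qed.

Lemma quotmod_piD : {morph quotmod_pi : x y / x + y}.
Proof. by move=> x y; rewrite /quotmod_pi !piE. Qed.

Definition quotmod_scale (a : R) (q : quotmod) : quotmod :=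
  quotmod_pi (a *: repr q).

Lemma quotmod_scaleE a x :
  quotmod_scale a (quotmod_pi x) = quotmod_pi (a *: x).
Proof.
apply/eq_quotmod_pi; rewrite -scalerBr rpredZ //.
by apply/eq_quotmod_pi; rewrite /quotmod_pi reprK.
Qed.

Lemma quotmod_scaleA a b q :
  quotmod_scale a (quotmod_scale b q) = quotmod_scale (a * b) q.
Proof. by have [x ->] := quotmod_piP q; rewrite !quotmod_scaleE scalerA. Qed.

Lemma quotmod_scale1 : left_id 1 quotmod_scale.
Proof. by move=> q; have [x ->] := quotmod_piP q; rewrite quotmod_scaleE scale1r. Qed.

Lemma quotmod_scaleDr : right_distributive quotmod_scale +%R.
Proof.
move=> a p q; have [x ->] := quotmod_piP p; have [y ->] := quotmod_piP q.
by rewrite -quotmod_piD !quotmod_scaleE scalerDr quotmod_piD.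
Qed.

Lemma quotmod_scaleDl q : {morph quotmod_scale^~ q : a b / a + b}.
Proof.
move=> a b; have [x ->] := quotmod_piP q.
by rewrite !quotmod_scaleE scalerDl quotmod_piD.
Qed.

HB.instance Definition _ := GRing.Zmodule_isLmodule.Build R quotmod
  quotmod_scaleA quotmod_scale1 quotmod_scaleDr quotmod_scaleDl.

Lemma quotmod_pi_linear : linear quotmod_pi.
Proof. by move=> a x y; rewrite quotmod_piD -quotmod_scaleE. Qed.

HB.instance Definition _ :=
  GRing.isLinear.Build R V quotmod _ quotmod_pi quotmod_pi_linear.

End QuotientModule.

(* The free R-module on I: the functions I -> R with finite support. *)
Section FreeModule.
Variables (R : pzRingType) (I : choiceType).

Definition fin_supp : {pred I -> R^o} :=
  fun f => `[< finite_set (f @^-1` [set~ 0]) >].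

Lemma fin_supp_closed : submod_closed fin_supp.
Proof.
split=> [|a f g /asboolP ff /asboolP fg]; apply/asboolP.
  by apply: (sub_finite_set _ (finite_set0 I)) => i /=; apply.
apply: (sub_finite_set (B := f @^-1` [set~ 0] `|` g @^-1` [set~ 0])).
  move=> i /= fgi; have [fi0|/eqP] := eqVneq (f i) 0; last by left.
  right=> gi0; apply: fgi.
  by rewrite /GRing.add /= /GRing.scale /= fi0 gi0 scaler0 addr0.
by rewrite finite_setU.
Qed.

HB.instance Definition _ :=
  GRing.isSubmodClosed.Build R (I -> R^o) fin_supp fin_supp_closed.

Record freemod := Freemod { freemod_val :> I -> R^o;
                            _ : freemod_val \in fin_supp }.

HB.instance Definition _ := [isSub for freemod_val].
HB.instance Definition _ := [Choice of freemod by <:].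
HB.instance Definition _ := [SubChoice_isSubLmodule of freemod by <:].

Lemma finite_supp (f : freemod) : finite_set (f @^-1` [set~ 0]).
Proof. by case: f => f /= /asboolP. Qed.

Lemma free_basis_subproof (i : I) :
  (fun j => (j == i)%:R : R^o) \in fin_supp.
Proof.
apply/asboolP/(sub_finite_set _ (finite_set1 i)) => j /=.
by case: eqP => // _; apply: contra_notP.
Qed.

Definition free_basis (i : I) : freemod := Freemod (free_basis_subproof i).

Section Lift.
Variables (P : lmodType R) (h : I -> P).

Definition free_lift (f : freemod) : P := \sum_(i \in [set: I]) (f i : R) *: h i.

Lemma free_liftE (f : freemod) (D : set I) : finite_set D ->
  f @^-1` [set~ 0] `<=` D -> free_lift f = \sum_(i \in D) (f i : R) *: h i.
Proof.
move=> _ fD; symmetry; apply: fsbig_widen => // i [_ /= nDi].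
have [->|/eqP fi0] := eqVneq (f i) 0; first by rewrite scale0r.
by case: nDi; apply: fD.
Qed.

Lemma free_lift_linear : linear free_lift.
Proof.
move=> a f g; pose D := f @^-1` [set~ 0] `|` g @^-1` [set~ 0].
have finD : finite_set D.
  by rewrite finite_setU; split; exact: finite_supp.
have afgD : (a *: f + g : freemod) @^-1` [set~ 0] `<=` D.
  move=> i /= fgi; have [fi0|/eqP] := eqVneq (f i) 0; last by left.
  right=> gi0; apply: fgi; change (a *: f i + g i = 0).
  by rewrite fi0 gi0 scaler0 addr0.
rewrite !(free_liftE finD) //; [|by move=> i; right|by move=> i; left].
rewrite !fsbig_finite // scaler_sumr -big_split; apply: eq_bigr => i _ /=.
by rewrite scalerA -scalerDl.
Qed.

HB.instance Definition _ :=
  GRing.isLinear.Build R freemod P _ free_lift free_lift_linear.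

Lemma free_lift_basis i : free_lift (free_basis i) = h i.
Proof.
rewrite (free_liftE (finite_set1 i)) ?fsbig_set1 /= ?eqxx ?scale1r //.
by move=> j /=; case: eqP => // _; apply: contra_notP.
Qed.

End Lift.
End FreeModule.

Arguments freemod : clear implicits.
Arguments free_basis {R I}.

Section Tensor.
Variables (R : comPzRingType) (M N : lmodType R).

Local Notation e m n := (free_basis (m, n)).

Inductive tensor_rel : set (freemod R (M * N)%type) :=
| TensorDl m m' n : tensor_rel (e (m + m') n - (e m n + e m' n))
| TensorDr m n n' : tensor_rel (e m (n + n') - (e m n + e m n'))
| TensorZl a m n : tensor_rel (e (a *: m) n - a *: e m n)
| TensorZr a m n : tensor_rel (e m (a *: n) - a *: e m n).

Definition tensor := quotmod (gen_submod tensor_rel).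
HB.instance Definition _ := GRing.Lmodule.on tensor.

Definition tens (m : M) (n : N) : tensor := quotmod_pi _ (e m n).

Definition bilin (P : lmodType R) (b : M -> N -> P) : Prop :=
  [/\ forall m m' n, b (m + m') n = b m n + b m' n,
      forall m n n', b m (n + n') = b m n + b m n',
      forall a m n, b (a *: m) n = a *: b m n &
      forall a m n, b m (a *: n) = a *: b m n].

Lemma tens_bilin : bilin tens.
Proof.
have D x y : tensor_rel (x - y) ->
    quotmod_pi (gen_submod tensor_rel) x = quotmod_pi _ y.
  by move=> xy; apply/eq_quotmod_pi/mem_gen_submod.
split=> [m m' n|m n n'|a m n|a m n]; rewrite /tens.
- by rewrite (D _ _ (TensorDl m m' n)) linearD.
- by rewrite (D _ _ (TensorDr m n n')) linearD.
- by rewrite (D _ _ (TensorZl a m n)) linearZ.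
- by rewrite (D _ _ (TensorZr a m n)) linearZ.
Qed.

Section Lift.
Variables (P : lmodType R) (b : M -> N -> P).

Definition tensor_lift (t : tensor) : P := free_lift (fun p => b p.1 p.2) (repr t).

Hypothesis b_bilin : bilin b.

Lemma tensor_lift_pi f :
  tensor_lift (quotmod_pi _ f) = free_lift (fun p => b p.1 p.2) f.
Proof.
have [bDl bDr bZl bZr] := b_bilin.
pose L := free_lift (fun p : M * N => b p.1 p.2).
have LE m n : L (e m n) = b m n by exact: free_lift_basis.
have LB u v : L (u - v) = L u - L v by exact: linearB.
have LD u v : L (u + v) = L u + L v by exact: linearD.
have LZ a u : L (a *: u) = a *: L u by exact: linearZ.
have LK g : g \in gen_submod tensor_rel -> L g = 0.
  move=> /asboolP /(_ (fun g => L g == 0)) gP; apply/eqP/gP.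
    split=> [|a u v /eqP u0 /eqP v0]; apply/eqP; first exact: linear0.
    by rewrite LD LZ u0 v0 scaler0 addr0.
  by move=> _ [m m' n|m n n'|a m n|a m n]; apply/eqP;
    rewrite LB ?LD ?LZ !LE ?(bDl, bDr, bZl, bZr) subrr.
apply/eqP; rewrite -subr_eq0 -[_ - _]LB; apply/eqP/LK/eq_quotmod_pi.
by rewrite /quotmod_pi reprK.
Qed.

Lemma tensor_lift_linear : linear tensor_lift.
Proof.
move=> a u v; have [f ->] := quotmod_piP u; have [g ->] := quotmod_piP v.
by rewrite -linearP !tensor_lift_pi linearP.
Qed.

Lemma tensor_lift_tens m n : tensor_lift (tens m n) = b m n.
Proof. by rewrite tensor_lift_pi free_lift_basis. Qed.

End Lift.

End Tensor.

Section TensorMap.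
Variables (R : comPzRingType) (A B M : lmodType R) (f : {linear A -> B}).

(* f (x) id_M *)
Definition tensor_map : tensor A M -> tensor B M :=
  tensor_lift (fun a m => tens (f a) m).

Lemma tensor_map_bilin : bilin (fun a m => tens (f a) m : tensor B M).
Proof.
have [Dl Dr Zl Zr] := tens_bilin B M.
by split=> *; rewrite ?linearD ?linearZ ?(Dl, Dr, Zl, Zr).
Qed.

HB.instance Definition _ := GRing.isLinear.Build R (tensor A M) (tensor B M) _
  tensor_map (tensor_lift_linear tensor_map_bilin).

Lemma tensor_map_tens a m : tensor_map (tens a m) = tens (f a) m.
Proof. exact: tensor_lift_tens tensor_map_bilin a m. Qed.

End TensorMap.

Arguments tensor_map {R A B} M f.

Section ModuleProperties.
Variables (R : comPzRingType) (M : lmodType R).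

Definition flat_module : Prop :=
  forall (A B : lmodType R) (f : {linear A -> B}),
    injective f -> injective (tensor_map M f).

Definition free_module : Prop :=
  exists (I : choiceType) (phi : {linear freemod R I -> M}), bijective phi.

Definition projective_module : Prop :=
  forall (A B : lmodType R) (g : {linear A -> B}) (f : {linear M -> B}),
    (forall b, exists a, g a = b) ->
    exists h : {linear M -> A}, forall x, g (h x) = f x.

Definition finitely_generated : Prop :=
  exists (n : nat) (x : 'I_n -> M),
    forall y, exists c : 'I_n -> R, y = \sum_i c i *: x i.

(* There is an exact sequence R^m -> R^n -> M -> 0. *)
Definition finitely_presented : Prop :=
  exists (m n : nat) (q : {linear 'rV[R]_m -> 'rV[R]_n})
         (p : {linear 'rV[R]_n -> M}),
    (forall y, exists x, p x = y) /\
    (forall x, p x = 0 <-> exists z, q z = x).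

End ModuleProperties.

Section FinitelyProjective.
Variables (R : comPzRingType) (M : lmodType R).

Definition finitely_projective : Prop :=
  forall (S : pred M) (N : subLmodType S), finitely_generated N ->
    exists (F : lmodType R) (u : {linear N -> F}) (v : {linear F -> M}),
      free_module F /\ forall x : N, v (u x) = \val x.

Definition fp_injective : Prop :=
  forall (B : lmodType R) (S : pred B) (A : subLmodType S),
    finitely_presented B -> finitely_generated A ->
    forall f : {linear A -> M},
      exists g : {linear B -> M}, forall x : A, g (\val x) = f x.

End FinitelyProjective.

Definition perfect_ring (R : comPzRingType) : Prop :=
  forall M : lmodType R, flat_module M -> projective_module M.

(* Main.v *)
Require Import Defs.
From HB Require Import structures.
From mathcomp Require Import all_boot all_algebra ring.
From mathcomp Require Import boolp classical_sets functions cardinality fsbigop.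

Set Implicit Arguments.
Unset Strict Implicit.
Unset Printing Implicit Defensive.

Import GRing.Theory.
Local Open Scope ring_scope.

(* Write Q for the total quotient ring.

   If Q is perfect and M is a flat R-module, then Q (x) M is a flat, hence
   projective, Q-module containing M. Dual basis coordinates of generators x_i of
   a submodule, once denominators are cleared, give linear equations over R
   expressing regular multiples of the x_i; solving them in M by the equational
   criterion of flatness factors the inclusion through a free R-module.

   Conversely, for a sequence a_n in R the direct limit of R -> R -> ... along
   the a_n is flat. Finite projectivity, applied to its first generator, yields
   finitely many u_k such that some product a_0 ... a_(l-1) lies in the ideal of
   the u_k, while the u_k are killed by the annihilator of every such product.
   Principal ideals of a self FP-injective ring are annihilators, so in Q the u_k
   are multiples of all these products: Q has the descending chain condition on
   principal ideals. Such a ring is perfect (Bass): by well-founded induction on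
   idempotents one reduces to a local situation, where a maximal family that is
   independent modulo the nil ideal is a basis of a flat module. *)

(** * Linear maps, tensors and free modules *)

Section LinearMaps.
Variables (R : comPzRingType) (V W : lmodType R).

(** Two values at x differ by a value at 0, so the relation is a graph. This defines linear maps
    through coefficients that are not unique. *)
Lemma linear_of_relation (H : V -> W -> Prop) :
  (forall x, exists y, H x y) ->
  (forall a x x' y y', H x y -> H x' y' -> H (a *: x + x') (a *: y + y')) ->
  (forall y, H 0 y -> y = 0) ->
  exists h : {linear V -> W}, forall x, H x (h x).
Proof.
move=> tot lin fun0; have [h hP] := choice tot.
have uniqH x y y' : H x y -> H x y' -> y = y'.
  move=> xy xy'; apply/eqP; rewrite -subr_eq0; apply/eqP/fun0.
  have := lin (-1) _ _ _ _ xy' xy.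
  by rewrite !scaleN1r addNr addrC.
have hlin : linear h.
  by move=> a x y; apply: uniqH (hP _) _; exact: lin.
pose h' : {linear V -> W} := HB.pack h (GRing.isLinear.Build R V W _ h hlin).
by exists h'.
Qed.

Lemma quotmod_lift (K : submodClosed V) (f : {linear V -> W}) :
  (forall v, v \in K -> f v = 0) ->
  exists g : {linear quotmod K -> W}, forall v, g (quotmod_pi K v) = f v.
Proof.
move=> fK; have wd v : f (repr (quotmod_pi K v)) = f v.
  apply/eqP; rewrite -subr_eq0 -linearB; apply/eqP/fK/eq_quotmod_pi.
  by rewrite /quotmod_pi reprK.
pose g (q : quotmod K) := f (repr q).
have glin : linear g.
  move=> a p q; have [x ->] := quotmod_piP p; have [y ->] := quotmod_piP q.
  by rewrite -linearP /g !wd linearP.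
pose g' : {linear quotmod K -> W} := HB.pack g (GRing.isLinear.Build R _ W _ g glin).
by exists g'.
Qed.

Lemma linear_comb (f : {linear V -> W}) (I : Type) (s : seq I) (c : I -> R) (x : I -> V) :
  f (\sum_(i <- s) c i *: x i) = \sum_(i <- s) c i *: f (x i).
Proof. by rewrite (raddf_sum f); apply: eq_bigr => i _; rewrite /= linearZZ. Qed.

End LinearMaps.

Section TensorFacts.
Variables (R : comPzRingType) (A M : lmodType R).

Lemma tensDl a a' (m : M) : tens (a + a' : A) m = tens a m + tens a' m.
Proof. by case: (tens_bilin A M). Qed.

Lemma tensDr (a : A) (m m' : M) : tens a (m + m') = tens a m + tens a m'.
Proof. by case: (tens_bilin A M). Qed.

Lemma tensZl c (a : A) (m : M) : tens (c *: a) m = c *: tens a m.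
Proof. by case: (tens_bilin A M). Qed.

Lemma tensZr c (a : A) (m : M) : tens a (c *: m) = c *: tens a m.
Proof. by case: (tens_bilin A M). Qed.

Lemma tens0l (m : M) : tens (0 : A) m = 0.
Proof. by rewrite -(scale0r 0) tensZl scale0r. Qed.

Lemma tens0r (a : A) : tens a (0 : M) = 0.
Proof. by rewrite -(scale0r 0) tensZr scale0r. Qed.

Lemma tens_suml (J : Type) (s : seq J) (F : J -> A) (m : M) :
  tens (\sum_(j <- s) F j) m = \sum_(j <- s) tens (F j) m.
Proof. by elim/big_rec2: _ => [|j x y _ <-]; rewrite ?tens0l ?tensDl. Qed.

Lemma tens_sumr (J : Type) (s : seq J) (a : A) (F : J -> M) :
  tens a (\sum_(j <- s) F j) = \sum_(j <- s) tens a (F j).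
Proof. by elim/big_rec2: _ => [|j x y _ <-]; rewrite ?tens0r ?tensDr. Qed.

End TensorFacts.

Section FreeFacts.
Variables (R : comPzRingType) (I : choiceType).

Lemma free_lift_seq (P : lmodType R) (h : I -> P) (s : seq I) (f : freemod R I) :
  uniq s -> (forall i, i \notin s -> f i = 0) ->
  free_lift h f = \sum_(i <- s) (f i : R) *: h i.
Proof.
move=> us fs; rewrite (@free_liftE _ _ _ h f [set` s]%classic).
- by rewrite -fsbig_seq.
- exact: finite_seq.
- by move=> i /= fi; apply/negPn/negP => /fs.
Qed.

Lemma free_support (f : freemod R I) :
  exists2 s : seq I, uniq s & forall i, i \notin s -> f i = 0.
Proof.
have /finite_seqP[s sE] := finite_supp f.
exists (undup s); first exact: undup_uniq.
move=> i; rewrite mem_undup; apply: contraNeq => /eqP fi.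
by have : [set` s]%classic i by rewrite -sE.
Qed.

Lemma freemod_sumE (J : Type) (s : seq J) (F : J -> freemod R I) i :
  (\sum_(j <- s) F j : freemod R I) i = \sum_(j <- s) F j i.
Proof. by elim/big_rec2: _ => // j x y _ <-. Qed.

Lemma free_basis_expand (s : seq I) (f : freemod R I) :
  uniq s -> (forall i, i \notin s -> f i = 0) ->
  f = \sum_(i <- s) (f i : R) *: free_basis i.
Proof.
move=> us fs; apply/val_inj/funext => j; rewrite /= freemod_sumE.
have E i : (f i *: free_basis i : freemod R I) j = f i * (j == i)%:R by [].
under eq_bigr do rewrite E.
have [js|js] := boolP (j \in s).
  rewrite (bigD1_seq j) //= eqxx mulr1 big1 ?addr0 // => i ij.
  by rewrite eq_sym (negbTE ij) mulr0.
rewrite fs // big1_seq // => i /andP[_ si].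
by case: eqP js => [->|_ _]; rewrite ?si ?mulr0.
Qed.

End FreeFacts.

Section TensorInd.
Variables (R : comPzRingType) (A M : lmodType R).

Lemma tensor_ind (P : tensor A M -> Prop) :
  P 0 -> (forall x y, P x -> P y -> P (x + y)) -> (forall a m, P (tens a m)) ->
  forall t, P t.
Proof.
move=> P0 PD Pt t; have [f ->] := quotmod_piP t.
have [s us fs] := free_support f; rewrite (free_basis_expand us fs) linear_sum.
elim/big_ind: _ => // -[a m] _; rewrite linearZ.
by have := Pt (f (a, m) *: a) m; rewrite tensZl.
Qed.

(** Only additivity is asked, so that maps linear over different rings can be compared on pure
    tensors. *)
Lemma tensor_map_add_eq (P : zmodType) (f g : tensor A M -> P) :
  {morph f : x y / x + y} -> {morph g : x y / x + y} ->
  (forall a m, f (tens a m) = g (tens a m)) -> f =1 g.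
Proof.
move=> fD gD fg; apply: tensor_ind => [|x y fgx fgy|//]; last by rewrite fD gD fgx fgy.
have z (h : tensor A M -> P) : {morph h : x y / x + y} -> h 0 = 0.
  by move=> hD; apply: (addrI (h 0)); rewrite -hD !addr0.
by rewrite !z.
Qed.

End TensorInd.

(** * The equational criterion of flatness *)

Section EquationalCriterion.
Variables (R : comPzRingType) (M : lmodType R).

(** With K the kernel of the matrix a, R^I/K embeds in R^J, and flatness keeps this injective after
    tensoring with M. The tensor [t] built from w maps to 0, so it is 0 already, and w is a
    combination of families with coefficients in K. *)
Theorem flat_equational (I J : finType) (a : J -> I -> R) (w : I -> M) :
  flat_module M -> (forall j, \sum_i a j i *: w i = 0) ->
  exists (n : nat) (c : I -> 'I_n -> R) (y : 'I_n -> M),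
    (forall i, w i = \sum_k c i k *: y k) /\
    (forall j k, \sum_i a j i * c i k = 0).
Proof.
move=> flatM aw0.
pose V := I -> R^o; pose VJ := J -> R^o.
have VE b (u v : V) i : (b *: u + v) i = b * u i + v i by [].
have VJE b (u v : VJ) i : (b *: u + v) i = b * u i + v i by [].
pose A (v : V) : VJ := fun j => \sum_i a j i * v i.
have Alin : linear A.
  move=> b u v; apply/funext => j; rewrite VJE /A mulr_sumr -big_split.
  by apply: eq_bigr => i _ /=; rewrite VE; ring.
pose A' : {linear V -> VJ} := HB.pack A (GRing.isLinear.Build R V _ _ A Alin).
have Ksub : submod_closed (fun v : V => `[< A' v = 0 >]).
  split=> [|b u v /asboolP u0 /asboolP v0]; apply/asboolP; first exact: linear0.
  by rewrite linearP u0 v0 scaler0 addr0.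
pose K : submodClosed V := HB.pack (fun v : V => `[< A' v = 0 >])
  (GRing.isSubmodClosed.Build R V _ Ksub).
have [f fE] : exists f : {linear quotmod K -> VJ},
    forall v, f (quotmod_pi K v) = A' v.
  by apply: quotmod_lift => v /asboolP.
have finj : injective f.
  move=> p q; have [u ->] := quotmod_piP p; have [v ->] := quotmod_piP q.
  rewrite !fE => uv; apply/eq_quotmod_pi/asboolP.
  by rewrite linearB uv subrr.
pose Mn := I -> M.
have MnE b (u v : Mn) i : (b *: u + v) i = b *: u i + v i by [].
(* The submodule of M^I generated by the families (v_i m)_i with v in K. *)
pose KM (x : Mn) := exists2 s : seq (V * M), all (fun p => p.1 \in K) s &
  forall i, x i = \sum_(p <- s) p.1 i *: p.2.
have KMsub : submod_closed (fun x : Mn => `[< KM x >]).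
  split=> [|b x y /asboolP[s sK xs] /asboolP[t tK yt]]; apply/asboolP.
    by exists [::] => // i; rewrite big_nil.
  exists ([seq (p.1, b *: p.2) | p <- s] ++ t).
    by rewrite all_cat all_map tK andbT.
  move=> i; rewrite big_cat big_map MnE xs yt scaler_sumr; congr (_ + _).
  by apply: eq_bigr => p _; rewrite !scalerA mulrC.
pose W : submodClosed Mn := HB.pack (fun x : Mn => `[< KM x >])
  (GRing.isSubmodClosed.Build R Mn _ KMsub).
pose row (v : V) (m : M) : Mn := fun i => v i *: m.
(* Another representative of q changes the row by an element of W, so this is bilinear. *)
pose b (q : quotmod K) (m : M) : quotmod W := quotmod_pi W (row (repr q) m).
have bE v m : b (quotmod_pi K v) m = quotmod_pi W (row v m).
  apply/eq_quotmod_pi/asboolP; exists [:: (repr (quotmod_pi K v) - v, m)].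
    rewrite /= andbT; suff : repr (quotmod_pi K v) - v \in K by [].
    by apply/eq_quotmod_pi; rewrite /quotmod_pi reprK.
  by move=> i; rewrite big_seq1 /= scalerBl.
have b_bilin : bilin b.
  split=> [p q m|p m m'|c p m|c p m].
  - have [u ->] := quotmod_piP p; have [v ->] := quotmod_piP q.
    rewrite -linearD !bE -linearD; congr quotmod_pi; apply/funext => i.
    exact: scalerDl.
  - have [u ->] := quotmod_piP p; rewrite !bE -linearD; congr quotmod_pi.
    apply/funext => i; exact: scalerDr.
  - have [u ->] := quotmod_piP p; rewrite -linearZ !bE -linearZ; congr quotmod_pi.
    by apply/funext => i; rewrite /row /= -scalerA.
  - have [u ->] := quotmod_piP p; rewrite !bE -linearZ; congr quotmod_pi.
    by apply/funext => i; rewrite /row [RHS]scalerA mulrC -scalerA.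
pose L : {linear tensor (quotmod K) M -> quotmod W} :=
  HB.pack (tensor_lift b) (GRing.isLinear.Build R _ _ _ _ (tensor_lift_linear b_bilin)).
pose d i : V := fun i' => (i' == i)%:R.
pose t : tensor (quotmod K) M := \sum_i tens (quotmod_pi K (d i)) (w i).
have t0 : t = 0.
  apply: (flatM _ _ f finj); rewrite linear0 linear_sum.
  pose dj j : VJ := fun j' => (j' == j)%:R.
  have AdE i : A (d i) = \sum_j a j i *: dj j.
    apply/funext => j; rewrite /A (bigD1 i) //= /d eqxx mulr1 big1 ?addr0; last first.
      by move=> i' /negbTE ->; rewrite mulr0.
    have ev (F : J -> VJ) : (\sum_j' F j') j = \sum_j' F j' j.
      by elim/big_rec2: _ => // k x y _ <-.
    rewrite ev (bigD1 j) //= big1 ?addr0; first by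
      rewrite /dj /GRing.scale /= eqxx /GRing.scale /= mulr1.
    by move=> j' /negbTE jj; rewrite /dj /GRing.scale /= eq_sym jj /GRing.scale /= mulr0.
  transitivity (\sum_j tens (dj j) (\sum_i a j i *: w i)); last first.
    by rewrite big1 // => j _; rewrite aw0 tens0r.
  under [RHS]eq_bigr do rewrite tens_sumr.
  rewrite exchange_big; apply: eq_bigr => i _ /=.
  rewrite tensor_map_tens fE [A' _]AdE tens_suml; apply: eq_bigr => j _.
  by rewrite tensZl tensZr.
have LE : L t = quotmod_pi W w.
  transitivity (quotmod_pi W (\sum_i row (d i) (w i))).
    rewrite !linear_sum; apply: eq_bigr => i _.
    by rewrite [L _](tensor_lift_tens b_bilin) bE.
  congr quotmod_pi; apply/funext => i.
  have ev (F : I -> Mn) : (\sum_i' F i') i = \sum_i' F i' i.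
    by elim/big_rec2: _ => // k x y _ <-.
  rewrite ev (bigD1 i) //= big1 ?addr0; first by rewrite /row /d eqxx scale1r.
  by move=> i' ii; rewrite /row /d eq_sym (negbTE ii) scale0r.
have : w \in W.
  rewrite -(subr0 w); apply/eq_quotmod_pi.
  by rewrite -LE t0 !linear0.
move=> /asboolP[s sK ws].
(* The list certifying that w lies in W supplies the y_k as its module components and the columns of
   c as its kernel vectors. *)
exists (size s), (fun i k => (tnth (in_tuple s) k).1 i), (fun k => (tnth (in_tuple s) k).2).
split=> [i|j k]; first by rewrite ws big_tnth.
have /allP/(_ _ (mem_tnth k (in_tuple s)))/asboolP := sK.
by move=> /(congr1 (fun g => g j)).
Qed.
End EquationalCriterion.

(** * Extension of scalars *)

(* The unused argument lets canonical structure inference recover phi. *)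
Definition restr_scalars (R S : comPzRingType) (phi : {rmorphism R -> S})
  (A : lmodType S) : Type := A.

Section RestrictScalars.
Variables (R S : comPzRingType) (phi : {rmorphism R -> S}).

Local Notation restr := (restr_scalars phi).

Section Module.
Variable A : lmodType S.

HB.instance Definition _ := GRing.Zmodule.on (restr A).

Definition restr_scale (r : R) (a : restr A) : restr A := phi r *: (a : A).

Lemma restr_scaleA r r' a : restr_scale r (restr_scale r' a) = restr_scale (r * r') a.
Proof. by rewrite /restr_scale scalerA rmorphM. Qed.

Lemma restr_scale1 : left_id 1 restr_scale.
Proof. by move=> a; rewrite /restr_scale rmorph1 scale1r. Qed.

Lemma restr_scaleDr : right_distributive restr_scale +%R.
Proof. by move=> r a b; exact: scalerDr. Qed.

Lemma restr_scaleDl a : {morph restr_scale^~ a : r r' / r + r'}.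
Proof. by move=> r r'; rewrite /restr_scale rmorphD scalerDl. Qed.

HB.instance Definition _ := GRing.Zmodule_isLmodule.Build R (restr A)
  restr_scaleA restr_scale1 restr_scaleDr restr_scaleDl.

Lemma restr_scaleE (r : R) (a : restr A) : r *: a = phi r *: (a : A).
Proof. by []. Qed.

End Module.

Section Map.
Variables (A B : lmodType S) (f : {linear A -> B}).

Definition restr_map (a : restr A) : restr B := f a.

Lemma restr_map_linear : linear restr_map.
Proof. by move=> r a b; rewrite /restr_map [LHS]linearP. Qed.

HB.instance Definition _ :=
  GRing.isLinear.Build R (restr A) (restr B) _ restr_map restr_map_linear.

End Map.

Section Mul.
Variable A : lmodType S.

Definition restr_mul (s : S) (a : restr A) : restr A := s *: (a : A).

Lemma restr_mul_linear s : linear (restr_mul s).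
Proof.
move=> r a b; rewrite /restr_mul [LHS](@scalerDr S A); congr (_ + _).
by rewrite !restr_scaleE !scalerA mulrC.
Qed.

HB.instance Definition _ s :=
  GRing.isLinear.Build R (restr A) (restr A) _ (restr_mul s) (restr_mul_linear s).

End Mul.

Section ExtendScalars.
Variable M : lmodType R.

Definition extend (A : lmodType S) : Type := tensor (restr A) M.

Section Module.
Variable A : lmodType S.

HB.instance Definition _ := GRing.Zmodule.on (extend A).

Definition extend_scale (s : S) (t : extend A) : extend A :=
  tensor_map M (restr_mul s : {linear restr A -> restr A}) t.

Definition etens (a : A) (m : M) : extend A := tens (a : restr A) m.

Lemma extend_scale_etens s a m : extend_scale s (etens a m) = etens (s *: a) m.
Proof. exact: tensor_map_tens. Qed.

Lemma extend_scaleD s : {morph extend_scale s : x y / x + y}.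
Proof. by move=> x y; exact: linearD. Qed.

Lemma extend_scaleA s s' t : extend_scale s (extend_scale s' t) = extend_scale (s * s') t.
Proof.
move: t; apply: tensor_map_add_eq => [x y|x y|a m]; rewrite ?extend_scaleD //.
by rewrite !extend_scale_etens scalerA.
Qed.

Lemma extend_scale1 : left_id 1 extend_scale.
Proof.
apply: tensor_map_add_eq => [x y|x y|a m]; rewrite ?extend_scaleD //.
by rewrite extend_scale_etens scale1r.
Qed.

Lemma extend_scaleDl t : {morph extend_scale^~ t : s s' / s + s'}.
Proof.
move=> s s'; move: t; apply: tensor_map_add_eq => [x y|x y|a m].
- exact: extend_scaleD.
- by rewrite !extend_scaleD addrACA.
- by rewrite !extend_scale_etens scalerDl [LHS]tensDl.
Qed.

HB.instance Definition _ := GRing.Zmodule_isLmodule.Build S (extend A)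
  extend_scaleA extend_scale1 extend_scaleD extend_scaleDl.

Lemma scale_etens s a m : s *: etens a m = etens (s *: a) m.
Proof. exact: extend_scale_etens. Qed.

End Module.

Local Notation MS := (extend S^o).

(* The map A (x)_S (S (x)_R M) -> A (x)_R M is injective, which reduces flatness
   of S (x)_R M over S to that of M over R. *)
Section Assoc.
Variable A : lmodType S.

Definition restr_orbit (a : A) (s : restr S^o) : restr A := (s : S) *: a.

Lemma restr_orbit_linear a : linear (restr_orbit a).
Proof. by move=> r s s'; rewrite /restr_orbit scalerDl -scalerA. Qed.

HB.instance Definition _ a := GRing.isLinear.Build R (restr S^o) (restr A) _
  (restr_orbit a) (restr_orbit_linear a).

Definition assoc_bilin (a : A) (t : MS) : extend A :=
  tensor_map M (restr_orbit a : {linear restr S^o -> restr A}) t.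

Lemma assoc_bilin_etens a s m : assoc_bilin a (etens s m) = etens ((s : S) *: a) m.
Proof. exact: tensor_map_tens. Qed.

Lemma assoc_bilinD a : {morph assoc_bilin a : x y / x + y}.
Proof. by move=> x y; exact: linearD. Qed.

Lemma assoc_bilinP : bilin assoc_bilin.
Proof.
split=> [a a' t|a t t'|c a t|c a t].
- move: t; apply: tensor_map_add_eq => [x y|x y|s m].
  + exact: assoc_bilinD.
  + by rewrite !assoc_bilinD addrACA.
  + by rewrite !assoc_bilin_etens scalerDr [LHS]tensDl.
- exact: assoc_bilinD.
- move: t; apply: tensor_map_add_eq => [x y|x y|s m].
  + exact: assoc_bilinD.
  + by rewrite assoc_bilinD scalerDr.
  + by rewrite !assoc_bilin_etens scale_etens !scalerA mulrC.
- move: t; apply: tensor_map_add_eq => [x y|x y|s m].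
  + by rewrite scalerDr assoc_bilinD.
  + by rewrite assoc_bilinD scalerDr.
  + by rewrite scale_etens !assoc_bilin_etens scale_etens scalerA.
Qed.

Definition assoc : tensor A MS -> extend A := tensor_lift assoc_bilin.

Lemma assocD : {morph assoc : x y / x + y}.
Proof.
move=> x y; have := tensor_lift_linear assoc_bilinP 1 x y.
by rewrite !scale1r.
Qed.

Lemma assoc_tens a s m : assoc (tens a (etens (s : S^o) m)) = etens ((s : S) *: a) m.
Proof. by rewrite /assoc (tensor_lift_tens assoc_bilinP) assoc_bilin_etens. Qed.

(** Sending a (x) m to a (x) (1 (x) m) gives a left inverse, since s crosses the tensor product over
    S. *)
Lemma assoc_inj : injective assoc.
Proof.
pose b (a : restr A) (m : M) : restr (tensor A MS) := tens (a : A) (etens (1 : S^o) m).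
have bP : bilin b.
  split=> [a a' m|a m m'|c a m|c a m].
  - exact: tensDl.
  - by rewrite /b /etens tensDr [LHS]tensDr.
  - exact: tensZl.
  - transitivity (tens (a : A) (phi c *: etens (1 : S^o) m)); last exact: tensZr.
    rewrite /b scale_etens; congr (tens (_ : A)).
    exact: etrans (tensZr _ _ _) (esym (tensZl _ _ _)).
pose L : {linear tensor (restr A) M -> restr (tensor A MS)} :=
  HB.pack (tensor_lift b) (GRing.isLinear.Build R _ _ _ _ (tensor_lift_linear bP)).
have LE a m : L (etens a m) = tens (a : A) (etens (1 : S^o) m).
  exact: (tensor_lift_tens bP).
apply: (can_inj (g := L)).
have LD : {morph L : x y / x + y} by move=> x y; exact: linearD.
apply: tensor_map_add_eq => [x y|//|a t]; first by rewrite assocD LD.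
move: t; apply: tensor_map_add_eq => [x y|x y|s m].
- by rewrite tensDr assocD LD.
- exact: tensDr.
- rewrite -[tens s m]/(etens s m) assoc_tens LE tensZl -tensZr scale_etens.
  by rewrite [_ *: _]mulr1.
Qed.

End Assoc.

Theorem flat_extend : flat_module M -> flat_module MS.
Proof.
move=> flatM A B f finj.
have finj' : injective (restr_map f : restr A -> restr B) by [].
have := flatM _ _ (restr_map f : {linear restr A -> restr B}) finj'.
set g := tensor_map M _ => ginj.
have gD : {morph g : x y / x + y} by move=> x y; exact: linearD.
have E t : assoc (tensor_map MS f t) = g (assoc t).
  move: t; apply: tensor_map_add_eq => [x y|x y|a t].
  - by rewrite linearD assocD.
  - by rewrite assocD gD.
  - rewrite tensor_map_tens; move: t.
    apply: tensor_map_add_eq => [x y|x y|s m].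
    + by rewrite tensDr assocD.
    + by rewrite tensDr assocD gD.
    + rewrite -[tens s m]/(etens s m) !assoc_tens [g _]tensor_map_tens.
      rewrite /etens; congr (tens (_ : restr B) m).
      exact/esym/(linearZZ f (s : S) a).
by move=> x y xy; apply/assoc_inj/ginj; rewrite -!E xy.
Qed.

Definition extend_unit (m : M) : MS := etens (1 : S^o) m.

Lemma extend_unit_linear : linear (extend_unit : M -> restr MS).
Proof.
move=> r m m'; rewrite /extend_unit /etens tensDr; congr (_ + _).
transitivity (phi r *: etens (1 : S^o) m); last by [].
rewrite scale_etens; exact: etrans (tensZr _ _ _) (esym (tensZl _ _ _)).
Qed.

HB.instance Definition _ := GRing.isLinear.Build R M (restr MS) _
  extend_unit extend_unit_linear.

Lemma extend_unitD m m' : extend_unit (m + m') = extend_unit m + extend_unit m'.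
Proof. exact: linearD. Qed.

Lemma extend_unitZ r m : extend_unit (r *: m) = phi r *: extend_unit m.
Proof. exact: (linearZZ (extend_unit : {linear M -> restr MS})). Qed.

Lemma extend_unit0 : extend_unit 0 = 0.
Proof. exact: linear0. Qed.

Lemma extend_unit_sum (I : Type) (s : seq I) (m : I -> M) :
  extend_unit (\sum_(i <- s) m i) = \sum_(i <- s) extend_unit (m i).
Proof. exact: (raddf_sum extend_unit). Qed.

(** Up to identifying M with R (x) M this is phi (x) M, injective by flatness; the lift of scalar
    multiplication recovers m from 1 (x) m. *)
Lemma extend_unit_inj : injective phi -> flat_module M -> injective extend_unit.
Proof.
move=> phi_inj flatM.
pose f (r : R^o) : restr S^o := phi r.
have flin : linear f by move=> a r s; rewrite /f rmorphD rmorphM.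
pose f' : {linear R^o -> restr S^o} := HB.pack f (GRing.isLinear.Build R _ _ _ f flin).
have finj : injective f' by exact: phi_inj.
pose b (r : R^o) (m : M) : M := (r : R) *: m.
have bP : bilin b.
  split=> [r r' m|r m m'|c r m|c r m].
  - exact: scalerDl.
  - exact: scalerDr.
  - exact: esym (scalerA _ _ _).
  - by rewrite /b !scalerA mulrC.
have fE m : extend_unit m = tensor_map M f' (tens (1 : R^o) m).
  by rewrite [RHS]tensor_map_tens /= /f rmorph1.
move=> m m'; rewrite !fE => /(flatM _ _ _ finj)/(congr1 (tensor_lift b)).
by rewrite !(tensor_lift_tens bP) /b !scale1r.
Qed.

Section Denominators.
Variable D : mulrClosed R.
Hypothesis phi_den : forall q, exists2 s, s \in D & exists r, phi s * q = phi r.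

Lemma extend_den (z : MS) : exists2 s, s \in D & exists m, phi s *: z = extend_unit m.
Proof.
elim/tensor_ind: z => [|y z [s sD [m sm]] [t tD [n tn]]|q m].
- exists 1; first exact: rpred1.
  by exists 0; rewrite [LHS]scaler0 extend_unit0.
- exists (s * t); first exact: rpredM.
  exists (t *: m + s *: n); rewrite rmorphM [LHS]scalerDr.
  rewrite extend_unitD !extend_unitZ -sm -tn.
  by rewrite !scalerA [phi t * _]mulrC.
- have [s sD [r E]] := phi_den q; exists s => //; exists (r *: m).
  rewrite -[tens q m]/(etens (q : S^o) m) scale_etens extend_unitZ scale_etens.
  by congr etens; rewrite [LHS]E [RHS]mulr1.
Qed.

End Denominators.

End ExtendScalars.
End RestrictScalars.

(** * Descending chains of principal ideals and perfect rings *)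

Section WellFoundedDivisibility.
Variable R : comPzRingType.

(** Strict inclusion of aR in bR; its well-foundedness is the descending chain condition on
    principal ideals. *)
Definition strictly_below (a b : R) : Prop :=
  (exists c, a = b * c) /\ ~ exists c, b = a * c.

Definition principal_dcc : Prop := well_founded strictly_below.

Hypothesis dcc : principal_dcc.

(** Either x lies in xaR, or xa generates a strictly smaller ideal and induction applies. *)
Lemma dcc_power (x a : R) : exists n b, x * a ^+ n = x * a ^+ n.+1 * b.
Proof.
elim/(well_founded_ind dcc): x => x IH.
have [[c xac]|nx] := pselect (exists c, x = x * a * c).
  by exists 0, c; rewrite expr0 expr1 mulr1.
have [|n [b E]] := IH (x * a); first by split=> //; exists a.
by exists n.+1, b; rewrite [in LHS]exprS [in RHS]exprS !mulrA E; ring.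
Qed.

(** For e idempotent: p is nilpotent in the factor ring eR. The exponent 0 is possible only when e =
    0. *)
Definition nil_on (e p : R) : Prop := exists n, e * p ^+ n = 0.

Lemma nil_on0 e : nil_on e 0.
Proof. by exists 1; rewrite expr1 mulr0. Qed.

Lemma nil_on_nakayama e p a c : nil_on e p -> e * a = e * (a * p) * c -> e * a = 0.
Proof.
move=> [n pn] E.
have {}E k : e * a = e * a * (p * c) ^+ k.
  elim: k => [|k IH]; first by rewrite expr0 mulr1.
  by rewrite {1}IH exprSr {1}E; ring.
by rewrite (E n) exprMn; transitivity (e * p ^+ n * (a * c ^+ n)); [ring|rewrite pn mul0r].
Qed.

(** By Nakayama, a factor nilpotent on e makes the ideal of [e * a] strictly smaller unless it is 0.
    This plays the part of T-nilpotence. *)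
Lemma nil_on_ind e (Q : R -> Prop) :
  (forall a, e * a = 0 -> Q a) ->
  (forall a, (forall p, nil_on e p -> Q (a * p)) -> Q a) ->
  forall a, Q a.
Proof.
move=> Q0 QS; suff H x : forall a, x = e * a -> Q a by move=> a; exact: (H (e * a)).
elim/(well_founded_ind dcc): x => x IH a xE.
have [/Q0//|/eqP ea0] := eqVneq (e * a) 0.
apply: QS => p ep; apply: (IH (e * (a * p))) => //; split.
  by exists p; rewrite xE mulrA.
by rewrite xE => -[c /(nil_on_nakayama ep)].
Qed.

(* The case e = 0 is allowed. *)
Definition primitive (e : R) : Prop :=
  forall f, f * f = f -> e * f = f -> f = 0 \/ f = e.

(** The powers of a stabilise on e, which yields an idempotent [e * u] with u a power of [a * b]. If
    it is 0, a is nilpotent on e; if it is e, a is invertible on e. *)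
Lemma primitive_nil_or_unit e a :
  e * e = e -> primitive e -> nil_on e a \/ exists b, nil_on e (1 - a * b).
Proof.
move=> ee prim; have [n [b E]] := dcc_power e a.
have E1 : e * a ^+ n.+1 = e * a ^+ n.+1 * (a * b).
  by transitivity (e * a ^+ n * a); [rewrite exprS; ring|rewrite E; ring].
have {}E k : e * a ^+ n.+1 = e * a ^+ n.+1 * (a * b) ^+ k.
  by elim: k => [|k IH]; rewrite ?expr0 ?mulr1 // [(a * b) ^+ k.+1]exprSr mulrA -IH.
set u := (a * b) ^+ n.+1.
have uE : e * a ^+ n.+1 = e * a ^+ n.+1 * u by exact: E.
have [||f0|fe] := prim (e * u).
- have -> : e * u * (e * u) = e * e * a ^+ n.+1 * u * b ^+ n.+1.
    by rewrite /u exprMn; ring.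
  by rewrite ee -uE -mulrA -exprMn.
- by rewrite mulrA ee.
- left; exists n.+1; rewrite uE.
  by transitivity (e * u * a ^+ n.+1); [ring|rewrite f0 mul0r].
- right; exists (b * (a * b) ^+ n); exists 1%N.
  rewrite expr1 mulrBr mulr1 mulrA -exprS -[_ ^+ n.+1]/u fe.
  by rewrite subrr.
Qed.

End WellFoundedDivisibility.

(** * Flat modules on a primitive idempotent *)

Section PrimitiveComponent.
Variables (R : comPzRingType) (dcc : principal_dcc R) (M : lmodType R).
Variables (e : R) (ee : e * e = e) (prim : primitive e).

Local Notation P := (nil_on e).

Definition nil_part : set M := [set x | exists p y, P p /\ x = p *: y]%classic.
Definition nil_submod : {pred M} := gen_submod nil_part.
HB.instance Definition _ := GRing.SubmodClosed.on nil_submod.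

Definition supp_in (I : set M) (f : freemod R M) : Prop := forall y, f y != 0 -> I y.

Definition lift_self : {linear freemod R M -> M} := @free_lift R M M id.

(** Linear independence modulo N M, with N the ideal of elements nilpotent on e: coefficients vanish
    only modulo N. *)
Definition nil_indep (I : set M) : Prop :=
  forall f, supp_in I f -> lift_self f \in nil_submod -> forall y, P (f y).

Lemma mem_nil_submod p y : P p -> p *: y \in nil_submod.
Proof. by move=> pP; apply: mem_gen_submod; exists p, y. Qed.

Lemma supp_inP I a f g : supp_in I f -> supp_in I g -> supp_in I (a *: f + g).
Proof.
move=> fI gI y; have -> : (a *: f + g : freemod R M) y = a * f y + g y by [].
have [fy0|/fI//] := eqVneq (f y) 0.
by rewrite fy0 mulr0 add0r => /gI.
Qed.

Lemma supp_in0 I : supp_in I 0.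
Proof. by move=> y; rewrite eqxx. Qed.

Lemma supp_in_basis (I : set M) y : I y -> supp_in I (free_basis y).
Proof. by move=> Iy z /=; case: (z =P y) => [->//|_]; rewrite eqxx. Qed.

Lemma lift_self_basis y : lift_self (free_basis y) = y.
Proof. exact: free_lift_basis. Qed.

Lemma supp_in_sum I (J : Type) (s : seq J) (c : J -> R) (g : J -> freemod R M) :
  (forall j, supp_in I (g j)) -> supp_in I (\sum_(j <- s) c j *: g j).
Proof.
move=> gI; elim/big_rec: _ => [|j f _ fI]; first exact: supp_in0.
exact: supp_inP.
Qed.

(** Zorn's lemma applies because a relation has finite support. For x outside the span of a maximal
    I modulo N M, its coefficient in a relation is nilpotent on e or invertible modulo N; the latter
    would solve for x, so x could be adjoined. *)
Lemma maximal_nil_indep : exists2 I, nil_indep I &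
  forall x, exists2 g, supp_in I g & x - lift_self g \in nil_submod.
Proof.
have [F FP Fchain|I [Iind Imax]] := @Zorn_bigcup M nil_indep.
  move=> f fF; have [s us fs] := free_support f.
  (* One member of the chain contains the support of f; the second alternative is f = 0, as the
     chain may be empty. *)
  have [[X FX sX]|s0] : (exists2 X, F X & forall y, y \in s -> f y != 0 -> X y) \/
                        (forall y, y \in s -> f y = 0).
    elim: s {us fs} => [|y s [[X FX sX]|s0]]; first by right.
    - left; have [fy0|fy] := eqVneq (f y) 0.
        by exists X => // z; rewrite inE => /orP[/eqP->|/sX//]; rewrite fy0 eqxx.
      have [Y FY Yy] := fF _ fy.
      have [XY|YX] := Fchain _ _ FX FY.
        exists Y => // z; rewrite inE => /orP[/eqP->//|zs fz].
        by apply: XY; exact: sX.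
      exists X => // z; rewrite inE => /orP[/eqP-> _|/sX//].
      exact: YX.
    - have [fy0|fy] := eqVneq (f y) 0.
        by right=> z; rewrite inE => /orP[/eqP->|/s0].
      left; have [Y FY Yy] := fF _ fy; exists Y => // z.
      by rewrite inE => /orP[/eqP->//|/s0 ->]; rewrite eqxx.
    apply: (FP X FX) => y fy; apply: sX => //.
    by apply: contraNT fy => /fs ->.
  move=> _ y; have [/s0->|/fs->] := boolP (y \in s); exact: nil_on0.
exists I => // x; apply: contrapT => nx.
have Ix : ~ I x.
  move=> Ix; apply: nx; exists (free_basis x); first exact: supp_in_basis.
  by rewrite lift_self_basis subrr rpred0.
apply: (Imax (I `|` [set x])%classic).
  by split=> [y Iy|IxI]; [left|apply/Ix/IxI; right].
move=> f fI fPM.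
pose f' := f - f x *: free_basis x.
have f'E y : f' y = f y - f x * (y == x)%:R by [].
have fE : lift_self f = lift_self f' + f x *: x.
  by rewrite linearB linearZ /= lift_self_basis subrK.
have f'I : supp_in I f'.
  move=> y; rewrite f'E; have [->|yx] := eqVneq y x; first by rewrite mulr1 subrr eqxx.
  by rewrite mulr0 subr0 => /fI[//|/= yx']; rewrite yx' eqxx in yx.
have [Pfx|[b Pb]] := primitive_nil_or_unit dcc (f x) ee prim.
  have f'P : lift_self f' \in nil_submod.
    by rewrite -(addrK (f x *: x) (lift_self f')) -fE rpredB // mem_nil_submod.
  move=> y; have [->//|yx] := eqVneq y x.
  by have := Iind _ f'I f'P y; rewrite f'E (negbTE yx) mulr0 subr0.
(* The relation is solved for x, b being an inverse of [f x] up to an element nilpotent on e. *)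
case: nx; exists (- b *: f').
  by rewrite -[X in supp_in I X]addr0; apply: supp_inP => //; exact: supp_in0.
have -> : x - lift_self (- b *: f') = b *: lift_self f + (1 - f x * b) *: x.
  rewrite fE linearZ /= scaleNr opprK scalerDr -addrA [LHS]addrC; congr (_ + _).
  by rewrite scalerA scalerBl scale1r mulrC addrC subrK.
by apply: rpredD; [exact: rpredZ|exact: mem_nil_submod].
Qed.

Hypothesis flatM : flat_module M.
Variables (I : set M) (Iind : nil_indep I).
Hypothesis Imax : forall x, exists2 g, supp_in I g & x - lift_self g \in nil_submod.

(** By induction on a, every (e a) x is in the span: modulo the span, x is a sum of multiples p z
    with p nilpotent on e, and the induction covers a p. *)
Lemma nil_indep_span x : exists2 f, supp_in I f & e *: x = lift_self f.
Proof.
pose sp (x : M) := exists2 f, supp_in I f & x = lift_self f.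
have sp_lin a y z : sp y -> sp z -> sp (a *: y + z).
  move=> [f fI ->] [g gI ->]; exists (a *: f + g); first exact: supp_inP.
  by rewrite linearP.
have sp0 : sp 0 by exists 0; [exact: supp_in0|rewrite linear0].
suff H a : forall x, sp ((e * a) *: x) by have := H 1 x; rewrite mulr1.
elim/(nil_on_ind dcc (e := e)): a => [a ea0|a IH] {}x; first by rewrite ea0 scale0r.
have [g gI] := Imax x; set y := x - _ => yP.
have -> : (e * a) *: x = (e * a) *: lift_self g + (e * a) *: y.
  by rewrite -scalerDr addrC subrK.
apply: (sp_lin); first by exists g.
move: yP => /asboolP/(_ (fun y => `[< sp ((e * a) *: y) >])) H; apply/asboolP/H.
  split=> [|b u v /asboolP su /asboolP sv]; apply/asboolP; first by rewrite scaler0.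
  rewrite scalerDr scalerA [e * a * b]mulrC -[(b * _) *: u]scalerA; exact: sp_lin su sv.
move=> _ [p [z [pP ->]]]; apply/asboolP.
by rewrite scalerA -mulrA; exact: IH.
Qed.

(* A relation among elements w_i of I is lifted by flatness to vectors z_k;
   writing the e z_k in terms of I and using independence exhibits each e f(w_i)
   as a combination of all f(w_j) with coefficients nilpotent on e, so that the
   ideal they generate vanishes by Nakayama. *)
Lemma nil_indep_free f : supp_in I f -> lift_self f = 0 -> forall y, e * f y = 0.
Proof.
move=> fI f0; have [s us fs] := free_support f.
pose w (i : 'I_(size s)) := tnth (in_tuple s) i.
have wf0 : \sum_i f (w i) *: w i = 0.
  by rewrite -[RHS]f0 [RHS](free_lift_seq _ us fs) [RHS]big_tnth.
have [n [c [z [wz cf]]]] := @flat_equational R M _ unit (fun _ i => f (w i)) w flatM (fun=> wf0).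
have /choice[g gP] : forall k, exists h, supp_in I h /\ e *: z k = lift_self h.
  by move=> k; have [h hI zh] := nil_indep_span (z k); exists h.
pose d i : freemod R M := e *: free_basis (w i) - \sum_k c i k *: g k.
have dE i y : d i y = e * (y == w i)%:R - \sum_k c i k * g k y.
  rewrite -[d i y]/(e * (y == w i)%:R - (\sum_k c i k *: g k : freemod R M) y).
  by rewrite freemod_sumE.
have dP i y : f (w i) != 0 -> nil_on e (d i y).
  move=> fwi; apply: Iind y.
    apply: supp_inP; first by apply: supp_in_basis; exact: fI.
    rewrite -scaleN1r -[X in supp_in I X]addr0; apply: supp_inP; last exact: supp_in0.
    by apply: supp_in_sum => k; have [] := gP k.
  have -> : lift_self (d i) = e *: w i - e *: w i; last by rewrite subrr rpred0.
  rewrite linearB linearZ /= lift_self_basis; congr (_ - _).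
  rewrite [LHS](raddf_sum lift_self) wz scaler_sumr; apply: eq_bigr => k _.
  rewrite [LHS]linearZ; have [_ gk] := gP k.
  by transitivity (c i k *: (e *: z k)); [rewrite gk|rewrite !scalerA mulrC].
have fyE y : e * f y = \sum_i f (w i) * d i y.
  under eq_bigr do rewrite dE mulrBr mulr_sumr.
  rewrite sumrB exchange_big [X in _ - X]big1 ?subr0; last first.
    by move=> k _; under eq_bigr do rewrite mulrA; rewrite -mulr_suml (cf tt) mul0r.
  rewrite -(big_tnth _ _ (in_tuple s) xpredT (fun x => f x * (e * (y == x)%:R))).
  have [ys|ys] := boolP (y \in s).
    rewrite (bigD1_seq y) //= eqxx mulr1 big1 ?addr0 1?mulrC // => x xy.
    by rewrite eq_sym (negbTE xy) !mulr0.
  rewrite fs // mulr0 big1_seq // => x /andP[_ xs].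
  by case: eqP ys => [->|_ _]; rewrite ?xs // !mulr0.
suff H a : forall i, e * (a * f (w i)) = 0.
  move=> y; have [ys|/fs->] := boolP (y \in s); last by rewrite mulr0.
  by rewrite -(mul1r (f y)); have /tnthP[i ->] : y \in in_tuple s by [].
move: a; apply: (nil_on_ind dcc (e := e)) => [a ea0 i|a IH i].
  by rewrite mulrA ea0 mul0r.
have -> : e * (a * f (w i)) = e * (a * (e * f (w i))).
  by rewrite -{1}ee; ring.
rewrite fyE !mulr_sumr big1 // => j _.
have [->|fj] := eqVneq (f (w j)) 0; first by rewrite mul0r !mulr0.
transitivity (e * (a * d j (w i) * f (w j))); first by ring.
by apply: IH; exact: dP.
Qed.

(** For e idempotent this is projectivity of the summand eM, and for e = 1 that of M. *)
Definition projective_on : Prop :=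
  forall (A B : lmodType R) (g : {linear A -> B}) (f : {linear M -> B}),
    (forall b, exists a, g a = b) ->
    exists h : {linear M -> A}, forall x, g (h x) = f (e *: x).

Lemma projective_on_primitive0 : projective_on.
Proof.
move=> A B g f gsurj; have [a ga] := choice (fun y => gsurj (f y)).
(* The coordinates F of e x need not be unique, but e times them are; the factor e in the value
   makes the relation a function. *)
have [|c x x' z z'|z [F [FI F0 ->]]|h hP] := @linear_of_relation R M A
  (fun x z => exists F, [/\ supp_in I F, e *: x = lift_self F & z = e *: free_lift a F]).
- move=> x; have [F FI xF] := nil_indep_span x.
  by exists (e *: free_lift a F), F.
- move=> [F [FI xF ->]] [F' [FI' xF' ->]]; exists (c *: F + F'); split.
  + exact: supp_inP.
  + transitivity (c *: (e *: x) + e *: x'); first by rewrite scalerDr !scalerA mulrC.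
    by rewrite xF xF' linearP.
  + by rewrite linearP scalerDr !scalerA mulrC.
- rewrite scaler0 in F0.
  have [s us Fs] := free_support F.
  rewrite (free_lift_seq _ us Fs) scaler_sumr big1 // => y _.
  by rewrite scalerA (nil_indep_free FI) ?scale0r.
exists h => x; have [F [FI xF ->]] := hP x.
have gF : g (free_lift a F) = f (lift_self F).
  have [s us Fs] := free_support F.
  rewrite [lift_self F](free_lift_seq _ us Fs) (free_lift_seq _ us Fs) !linear_sum.
  by apply: eq_bigr => y _; rewrite !linearZZ ga.
by rewrite linearZZ gF -xF -linearZZ scalerA ee.
Qed.

End PrimitiveComponent.

(** * Perfectness from descending chains of principal ideals *)

Section DccPerfect.
Variables (R : comPzRingType) (dcc : principal_dcc R) (M : lmodType R).
Hypothesis flatM : flat_module M.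

Lemma projective_on_primitive e :
  e * e = e -> primitive e -> projective_on M e.
Proof.
move=> ee prim; have [I Iind Imax] := maximal_nil_indep dcc M ee prim.
exact: projective_on_primitive0 Iind Imax.
Qed.

(** A non-primitive e splits into orthogonal idempotents f and e - f generating strictly smaller
    ideals, and their lifts add up to one for e. *)
Lemma projective_on_idempotent e : e * e = e -> projective_on M e.
Proof.
elim/(well_founded_ind dcc): e => e IH ee.
have [/projective_on_primitive|nprim] := pselect (primitive e); first exact.
have [f [ff ef f0 fe]] : exists f, [/\ f * f = f, e * f = f, f <> 0 & f <> e].
  apply: contrapT => H; apply: nprim => f ff ef; apply: contrapT => nf.
  by apply: H; exists f; split=> // ?; apply: nf; [left|right].
have gg : (e - f) * (e - f) = e - f.
  by rewrite mulrBl !mulrBr ee ff ef mulrC ef subrr subr0.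
have /IH fproj : strictly_below f e.
  split; first by exists f.
  by move=> [c ec]; apply: fe; rewrite -ef ec mulrAC ff.
have /IH gproj : strictly_below (e - f) e.
  split; first by exists (e - f); rewrite mulrBr ee ef.
  move=> [c ec]; apply: f0; rewrite -ef ec.
  by rewrite mulrAC mulrBl ef ff subrr mul0r.
move=> A B g h gsurj.
have [h1 h1P] := fproj ff A B g h gsurj; have [h2 h2P] := gproj gg A B g h gsurj.
exists (h1 \+ h2) => x; rewrite /= linearD h1P h2P -linearD -scalerDl.
by rewrite addrC subrK.
Qed.

End DccPerfect.

Theorem principal_dcc_perfect (R : comPzRingType) : principal_dcc R -> perfect_ring R.
Proof.
move=> dcc M flatM A B g f gsurj.
have [h hP] := projective_on_idempotent dcc flatM (mulr1 1) f gsurj.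
by exists h => x; rewrite hP scale1r.
Qed.

(** * The Bass module *)

Section SubmoduleType.
Variables (R : comPzRingType) (V : lmodType R) (W : submodClosed V).

Record submodule := Submodule { submodule_val :> V; _ : submodule_val \in W }.

HB.instance Definition _ := [isSub for submodule_val].
HB.instance Definition _ := [Choice of submodule by <:].
HB.instance Definition _ := [SubChoice_isSubLmodule of submodule by <:].

End SubmoduleType.

Section Germs.
Variables (R : comPzRingType) (A : lmodType R).

Definition ev_zero : {pred nat -> A} :=
  fun f => `[< exists N, forall k, (N <= k)%N -> f k = 0 >].

Lemma ev_zero_closed : submod_closed ev_zero.
Proof.
split=> [|a f g /asboolP[N fN] /asboolP[N' gN']]; apply/asboolP; first by exists 0.
exists (maxn N N') => k; rewrite geq_max => /andP[Nk N'k].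
by rewrite -[LHS]/(a *: f k + g k) fN // gN' // scaler0 addr0.
Qed.

HB.instance Definition _ := GRing.isSubmodClosed.Build R (nat -> A) ev_zero ev_zero_closed.

Definition germ := quotmod ev_zero.
HB.instance Definition _ := GRing.Lmodule.on germ.

Definition germ_of (f : nat -> A) : germ := quotmod_pi ev_zero f.

Lemma germ_ofD : {morph germ_of : f g / f + g}.
Proof. exact: linearD. Qed.

Lemma germ_ofZ a f : germ_of (a *: f) = a *: germ_of f.
Proof. exact: linearZ. Qed.

Lemma germ_ofP q : exists f, q = germ_of f.
Proof. exact: quotmod_piP. Qed.

Lemma eq_germ_of f g :
  germ_of f = germ_of g <-> exists N, forall k, (N <= k)%N -> f k = g k.
Proof.
split=> [/eq_quotmod_pi/asboolP|] [N H].
  by exists N => k /H /eqP; rewrite -[_ k]/(f k - g k) subr_eq0 => /eqP.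
apply/eq_quotmod_pi/asboolP; exists N => k /H fg.
by rewrite -[LHS]/(f k - g k) fg subrr.
Qed.

Lemma germ_of0P f : germ_of f = 0 <-> exists N, forall k, (N <= k)%N -> f k = 0.
Proof.
have -> : 0 = germ_of 0 by rewrite /germ_of linear0.
exact: eq_germ_of.
Qed.

End Germs.

Section BassModule.
Variables (R : comPzRingType) (a : nat -> R).

(* The direct limit of R -> R -> ..., with successive maps the multiplications
   by a 0, a 1, ..., realised as germs of eventually compatible sequences. *)
Definition compatible_germ : {pred germ R^o} :=
  fun q => `[< exists f N, q = germ_of f /\
                 forall k, (N <= k)%N -> f k.+1 = a k * f k >].

Lemma compatible_germ_closed : submod_closed compatible_germ.
Proof.
split=> [|c p q /asboolP[f [N [-> fN]]] /asboolP[g [N' [-> gN']]]]; apply/asboolP.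
  exists 0, 0; split; first by rewrite /germ_of linear0.
  by move=> k _; rewrite -[LHS]/0 -[X in _ * X]/(0 : R) mulr0.
exists (c *: f + g), (maxn N N'); split; first by rewrite germ_ofD germ_ofZ.
move=> k; rewrite geq_max => /andP[Nk N'k].
have E j : (c *: f + g) j = c * f j + g j by [].
by rewrite !E fN // gN' //; ring.
Qed.

HB.instance Definition _ :=
  GRing.isSubmodClosed.Build R (germ R^o) compatible_germ compatible_germ_closed.

Definition bass := submodule compatible_germ.
HB.instance Definition _ := GRing.Lmodule.on bass.

(** The image of 1 from the n-th copy of R, with default value 0 before stage n. *)
Definition bass_seq (n k : nat) : R^o :=
  if (k < n)%N then 0 else \prod_(n <= i < k) a i.

Lemma bass_seqS n k : (n <= k)%N -> bass_seq n k.+1 = a k * bass_seq n k.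
Proof.
move=> nk; rewrite /bass_seq ltnNge leqW // ltnNge nk /=.
by rewrite big_nat_recr //= mulrC.
Qed.

Lemma bass_gen_subproof n : germ_of (bass_seq n) \in compatible_germ.
Proof. by apply/asboolP; exists (bass_seq n), n; split=> // k; exact: bass_seqS. Qed.

Definition bass_gen n : bass := Submodule (bass_gen_subproof n).

Lemma bass_genS n : bass_gen n = a n *: bass_gen n.+1.
Proof.
apply/val_inj; rewrite /= -[RHS]germ_ofZ; apply/eq_germ_of; exists n.+1 => k nk.
rewrite -[RHS]/(a n * bass_seq n.+1 k) /bass_seq ltnNge (ltnW nk) ltnNge nk /=.
by rewrite big_ltn.
Qed.

Lemma bass_gen_le n k : (n <= k)%N -> bass_gen n = (\prod_(n <= i < k) a i) *: bass_gen k.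
Proof.
elim: k => [|k IH]; first by rewrite leqn0 => /eqP->; rewrite big_geq // scale1r.
rewrite leq_eqVlt => /predU1P[->|nk]; first by rewrite big_geq // scale1r.
by rewrite IH // big_nat_recr //= -scalerA -bass_genS.
Qed.

Lemma bass_genP (x : bass) : exists n c, x = c *: bass_gen n.
Proof.
case: x => q qP; have /asboolP[f [N [qE fN]]] := qP.
exists N, (f N); apply/val_inj; rewrite /= qE -[RHS]germ_ofZ.
apply/eq_germ_of; exists N; elim=> [|k IH].
  rewrite leqn0 => /eqP N0; rewrite -[RHS]/(f N * bass_seq N 0) /bass_seq N0.
  by rewrite ltnn big_geq // mulr1.
rewrite leq_eqVlt => /predU1P[<-|Nk].
  by rewrite -[RHS]/(f N * bass_seq N N) /bass_seq ltnn big_geq // mulr1.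
rewrite fN // IH // -[RHS]/(f N * bass_seq N k.+1) bass_seqS //.
by rewrite -[X in _ * X = _]/(f N * bass_seq N k); ring.
Qed.

Lemma bass_gen_eq0 n c : c *: bass_gen n = 0 ->
  exists2 k, (n <= k)%N & c * \prod_(n <= i < k) a i = 0.
Proof.
move=> /(congr1 val) /=; rewrite -[LHS]germ_ofZ => /germ_of0P[N H].
exists (maxn n N); first exact: leq_maxl.
have := H _ (leq_maxr n N); rewrite -[LHS]/(c * bass_seq n (maxn n N)) /bass_seq.
by rewrite ltnNge leq_maxl.
Qed.

(* The map A (x) bass -> germ A detects the vanishing of tensors, and germ
   preserves injections. *)
Section Germify.
Variable A : lmodType R.

Definition germify (x : A) (y : bass) : germ A :=
  germ_of (fun k => (repr (val y) k : R) *: x).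

Lemma germifyE x (y : bass) f :
  val y = germ_of f -> germify x y = germ_of (fun k => (f k : R) *: x).
Proof.
move=> yf; have : germ_of (repr (val y)) = germ_of f.
  by rewrite -yf /germ_of /quotmod_pi reprK.
move=> /eq_germ_of[N H]; apply/eq_germ_of; exists N => k /H.
by rewrite /germify => ->.
Qed.

Lemma germify_bilin : bilin germify.
Proof.
split=> [x x' y|x y y'|c x y|c x y].
- rewrite /germify -germ_ofD; congr germ_of; apply/funext => k; exact: scalerDr.
- have [f yf] := germ_ofP (val y); have [g yg] := germ_ofP (val y').
  rewrite (germifyE _ yf) (germifyE _ yg) (@germifyE _ _ (f + g)) -?germ_ofD.
    congr germ_of; apply/funext => k; exact: scalerDl.
  by rewrite germ_ofD -yf -yg.
- rewrite /germify -germ_ofZ; congr germ_of; apply/funext => k.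
  by rewrite -[RHS]/(c *: (_ *: x)) !scalerA mulrC.
- have [f yf] := germ_ofP (val y).
  rewrite (germifyE _ yf) (@germifyE _ _ (c *: f)) -?germ_ofZ.
    congr germ_of; apply/funext => k; exact: esym (scalerA _ _ _).
  by rewrite germ_ofZ -yf.
Qed.

Lemma tens_bassP (t : tensor A bass) : exists n x, t = tens x (bass_gen n).
Proof.
have up n k x : (n <= k)%N ->
    exists x', tens x (bass_gen n) = tens (x' : A) (bass_gen k).
  move=> nk; exists ((\prod_(n <= i < k) a i) *: x).
  by rewrite (bass_gen_le nk) tensZr tensZl.
elim/tensor_ind: t => [|_ _ [n [x ->]] [m [y ->]]|x y].
- by exists 0, 0; rewrite tens0l.
- have [x' ->] := up _ _ x (leq_maxl n m); have [y' ->] := up _ _ y (leq_maxr n m).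
  by exists (maxn n m), (x' + y'); rewrite tensDl.
- by have [n [c ->]] := bass_genP y; exists n, (c *: x); rewrite tensZr tensZl.
Qed.

Lemma tens_bass_eq0 n (x : A) : tens x (bass_gen n) = 0 ->
  exists2 k, (n <= k)%N & (\prod_(n <= i < k) a i) *: x = 0.
Proof.
move=> t0; have := tensor_lift_tens germify_bilin x (bass_gen n).
pose L : {linear tensor A bass -> germ A} := HB.pack (tensor_lift germify)
  (GRing.isLinear.Build R _ _ _ _ (tensor_lift_linear germify_bilin)).
rewrite t0 [LHS](linear0 L) (germifyE _ (erefl : val (bass_gen n) = germ_of _)).
move=> /esym/germ_of0P[N H]; exists (maxn n N); first exact: leq_maxl.
have := H _ (leq_maxr n N).
by rewrite /bass_seq ltnNge leq_maxl.
Qed.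

End Germify.

(** Every tensor is x (x) g_n with g_n = [bass_gen n]. If its image vanishes, some product of the
    a_i kills f x, hence x; that product can be moved across the tensor sign. *)
Theorem flat_bass : flat_module bass.
Proof.
move=> A B f finj t t' /eqP; rewrite -subr_eq0 -linearB => /eqP.
have [n [x tE]] := tens_bassP (t - t'); rewrite tE [LHS]tensor_map_tens.
move=> /tens_bass_eq0[k nk fx0].
apply/eqP; rewrite -subr_eq0 tE (bass_gen_le nk) tensZr -tensZl.
have -> : (\prod_(n <= i < k) a i) *: x = 0; last by rewrite tens0l.
by apply: finj; rewrite linear0 linearZZ.
Qed.

End BassModule.

(** * Finitely projective modules *)

Section DualFamilies.
Variable R : comPzRingType.

(** A factorisation through R^p sending x_i to the row c_i; the second clause makes it well defined
    on the span of the x_i. *)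
Definition dual_family (M : lmodType R) n (x : 'I_n -> M) : Prop :=
  exists p (c : 'I_n -> 'I_p -> R) (y : 'I_p -> M),
    (forall i, x i = \sum_k c i k *: y k) /\
    forall r, \sum_i r i *: x i = 0 -> forall k, \sum_i r i * c i k = 0.

Lemma dual_family_free (N F M : lmodType R) (u : {linear N -> F}) (v : {linear F -> M})
    n (x : 'I_n -> N) :
  injective (v \o u) -> free_module F -> dual_family (fun i => v (u (x i))).
Proof.
move=> vu_inj [I [phi [psi psiK phiK]]].
(* A finite list containing the supports of all [u (x i)], so that finitely many basis vectors
   suffice. *)
have [s us xs] : exists2 s : seq I, uniq s &
    forall i j, j \notin s -> psi (u (x i)) j = 0.
  have /choice[t tP] : forall i, exists t : seq I,
      forall j, j \notin t -> psi (u (x i)) j = 0.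
    by move=> i; have [t _ tP] := free_support (psi (u (x i))); exists t.
  exists (undup (flatten [seq t i | i <- enum 'I_n])); first exact: undup_uniq.
  move=> i j; rewrite mem_undup => js; apply: tP; apply: contraNN js => jt.
  by apply/flatten_mapP; exists i; rewrite ?mem_enum.
have uE i : u (x i) = \sum_(k < size s)
    psi (u (x i)) (tnth (in_tuple s) k) *: phi (free_basis (tnth (in_tuple s) k)).
  rewrite -{1}(phiK (u (x i))) {1}(free_basis_expand us (xs i)) linear_comb.
  exact: big_tnth.
exists (size s), (fun i k => psi (u (x i)) (tnth (in_tuple s) k)),
  (fun k => v (phi (free_basis (tnth (in_tuple s) k)))); split=> [i|r rx0 k].
  by rewrite {1}uE linear_comb.
have ux0 : u (\sum_i r i *: x i) = 0.
  rewrite -[RHS](linear0 u); congr (u _); apply: vu_inj.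
  by rewrite [RHS]/= !linear0 -[RHS]rx0 /= !linear_comb.
have phi0 : phi (\sum_i r i *: psi (u (x i))) = 0.
  rewrite -[RHS]ux0 !linear_comb; apply: eq_bigr => i _.
  by congr (_ *: _); exact: phiK.
have := congr1 (fun f => psi f (tnth (in_tuple s) k)) phi0.
rewrite psiK freemod_sumE -(linear0 phi) psiK => sum0.
exact: sum0.
Qed.

(** A projective M is a retract of the free module on its underlying set. *)
Lemma projective_dual_family (M : lmodType R) n (x : 'I_n -> M) :
  projective_module M -> dual_family x.
Proof.
pose v : {linear freemod R M -> M} := @free_lift R M M id.
move=> /(_ _ _ v (idfun : {linear M -> M})) [|h hP].
  by move=> y; exists (free_basis y); exact: free_lift_basis.
have free : free_module (freemod R M).
  by exists M, (idfun : {linear freemod R M -> freemod R M}); exists id.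
have -> : x = fun i => v (h (x i)) by apply/funext => i; rewrite hP.
by apply: dual_family_free => // y z /=; rewrite !hP.
Qed.

Section FinitelyProjectiveP.
Variable M : lmodType R.

Lemma finitely_projective_dual_family n (x : 'I_n -> M) :
  finitely_projective M -> dual_family x.
Proof.
move=> Mfp.
pose span : {pred M} := fun y => `[< exists c, y = \sum_i c i *: x i >].
have span_closed : submod_closed span.
  split=> [|a y z /asboolP[c ->] /asboolP[d ->]]; apply/asboolP.
    by exists (fun=> 0); rewrite big1 // => i _; rewrite scale0r.
  exists (fun i => a * c i + d i); rewrite scaler_sumr -big_split.
  by apply: eq_bigr => i _; rewrite scalerDl scalerA.
pose W : submodClosed M := HB.pack span (GRing.isSubmodClosed.Build R M _ span_closed).
have xW i : x i \in W.
  apply/asboolP; exists (fun j => (j == i)%:R).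
  rewrite (bigD1 i) //= eqxx scale1r big1 ?addr0 // => j /negbTE ->.
  by rewrite scale0r.
have valE m (s : 'I_m -> submodule W) : val (\sum_i s i) = \sum_i val (s i).
  exact: raddf_sum.
have Nfg : finitely_generated (submodule W).
  exists n, (fun i => Submodule (xW i)) => -[y yW]; have /asboolP[c yE] := yW.
  exists c; apply/val_inj; rewrite [RHS]valE /= yE.
  by apply: eq_bigr => i _.
have [F [u [v [freeF vu]]]] := Mfp _ (submodule W) Nfg.
have [|p [c [y [xE cP]]]] := dual_family_free (v := v) (u := u) (fun i => Submodule (xW i)) _ freeF.
  by move=> y z /=; rewrite !vu => /val_inj.
exists p, c, y; split=> [i|r rx0].
  by rewrite -xE vu.
apply: cP; rewrite -[RHS]rx0; apply: eq_bigr => i _.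
by rewrite vu.
Qed.

Lemma dual_family_finitely_projective :
  (forall n (x : 'I_n -> M), dual_family x) -> finitely_projective M.
Proof.
move=> dual S N [n [x xgen]].
have [p [c [y [xE cP]]]] := dual n (fun i => val (x i)).
pose lin (r : 'I_n -> R) : freemod R 'I_p := \sum_k (\sum_i r i * c i k) *: free_basis k.
have valE (r : 'I_n -> R) : val (\sum_i r i *: x i) = \sum_i r i *: val (x i).
  exact: (linear_comb (val : {linear N -> M})).
have [||z [r [zE ->]]|u uP] := @linear_of_relation R N (freemod R 'I_p)
  (fun z w => exists r, z = \sum_i r i *: x i /\ w = lin r).
- by move=> z; have [r zE] := xgen z; exists (lin r), r.
- move=> a _ _ _ _ [r [-> ->]] [r' [-> ->]]; exists (fun i => a * r i + r' i); split.
    rewrite scaler_sumr -big_split; apply: eq_bigr => i _.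
    by rewrite scalerDl scalerA.
  rewrite scaler_sumr -big_split; apply: eq_bigr => k _ /=.
  rewrite scalerA -scalerDl mulr_sumr -big_split; congr (_ *: _).
  by apply: eq_bigr => i _ /=; ring.
- rewrite /lin big1 // => k _; rewrite cP ?scale0r //.
  by rewrite -valE -zE linear0.
exists (freemod R 'I_p), u, (@free_lift R 'I_p M y); split.
  by exists 'I_p, (idfun : {linear freemod R 'I_p -> freemod R 'I_p}); exists id.
move=> z; have [r [zE ->]] := uP z.
rewrite [in RHS]zE valE linear_comb.
under eq_bigr => k _ do rewrite [GRing.Linear.sort _ _]free_lift_basis scaler_suml.
rewrite exchange_big; apply: eq_bigr => i _ /=; rewrite xE scaler_sumr.
by apply: eq_bigr => k _; rewrite scalerA.
Qed.

End FinitelyProjectiveP.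
End DualFamilies.

(** * Rings of fractions *)

(** The u_k are coordinates of the first generator g_0, so whatever kills g_0 kills them; and g_0 is
    a product times g_m. Writing all y_k at one stage n gives the identity at a later stage l. *)
Lemma bass_chain (R : comPzRingType) (a : nat -> R) : finitely_projective (bass a) ->
  exists l p (u : 'I_p -> R) (c : 'I_p -> R),
    \prod_(0 <= i < l) a i = \sum_k u k * c k /\
    forall m r, r * \prod_(0 <= i < m) a i = 0 -> forall k, r * u k = 0.
Proof.
move=> /(finitely_projective_dual_family (fun _ : 'I_1 => bass_gen a 0)).
move=> [p [u [y [genE uP]]]].
have [n [c yE]] : exists n (c : 'I_p -> R), forall k, y k = c k *: bass_gen a n.
  have /choice[d dP] : forall k, exists d : nat * R, y k = d.2 *: bass_gen a d.1.
    by move=> k; have [n [c yk]] := bass_genP (y k); exists (n, c).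
  exists (\max_k (d k).1), (fun k => (d k).2 * \prod_((d k).1 <= i < \max_k (d k).1) a i).
  by move=> k; rewrite dP -scalerA -bass_gen_le // leq_bigmax.
have [l nl lE] : exists2 l, (n <= l)%N &
    (\sum_k u ord0 k * c k - \prod_(0 <= i < n) a i) * \prod_(n <= i < l) a i = 0.
  apply: bass_gen_eq0; rewrite scalerBl -bass_gen_le // (genE ord0) scaler_suml.
  by apply/eqP; rewrite subr_eq0; apply/eqP/eq_bigr => k _; rewrite yE scalerA.
exists l, p, (u ord0), (fun k => c k * \prod_(n <= i < l) a i); split.
  rewrite (big_cat_nat _ nl) //=; apply/esym/eqP.
  rewrite -subr_eq0 -[X in _ == X]lE mulrBl mulr_suml; apply/eqP; congr (_ - _).
  by apply: eq_bigr => k _; rewrite mulrA.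
move=> m r rm k; have := uP (fun=> r); rewrite !big_ord1 (bass_gen_le a (leq0n m)).
by rewrite scalerA rm scale0r => /(_ erefl k); rewrite big_ord1.
Qed.

(** The map sending d x to d u is well defined on Qx; its extension to Q sends 1 to the required
    c. *)
Lemma fp_injective_annihilator (Q : comPzRingType) (x u : Q) : fp_injective Q^o ->
  (forall q, q * x = 0 -> q * u = 0) -> exists c, u = x * c.
Proof.
move=> Qfpi ann.
pose span : {pred Q^o} := fun y => `[< exists c : Q, y = c * x >].
have span_closed : submod_closed span.
  split=> [|a y z /asboolP[c ->] /asboolP[d ->]]; apply/asboolP.
    by exists 0; rewrite mul0r.
  by exists (a * c + d); rewrite mulrDl -mulrA.
pose W : submodClosed Q^o := HB.pack span (GRing.isSubmodClosed.Build Q Q^o _ span_closed).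
have xW : (x : Q^o) \in W by apply/asboolP; exists 1; rewrite mul1r.
have [|c y y' z z' [d [yE ->]] [d' [y'E ->]]|z [d [dx0 ->]]|f fP] :=
    @linear_of_relation Q (submodule W) Q^o
      (fun y z => exists d : Q, val y = d * x :> Q /\ z = d * u :> Q).
- by case=> y yW; have /asboolP[d yE] := yW; exists (d * u), d.
- exists (c * d + d'); split; last by rewrite mulrDl -mulrA.
  by rewrite -[LHS]/(c * val y + val y') yE y'E; ring.
- by apply: ann; rewrite -dx0.
have Bfp : finitely_presented (Q^o : lmodType Q).
  pose p (v : 'rV[Q]_1) : Q^o := v 0 0.
  have plin : linear p by move=> c v w; rewrite /p !mxE.
  pose p' : {linear 'rV[Q]_1 -> Q^o} := HB.pack p (GRing.isLinear.Build Q _ _ _ p plin).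
  exists 0, 1, (\0 : {linear 'rV[Q]_0 -> 'rV[Q]_1}), p'; split=> [y|v].
    by exists (\row_i y); rewrite /= /p mxE.
  split=> [v0|[z <-]]; last exact: linear0.
  by exists 0; apply/rowP => i; rewrite ord1 [RHS]v0 mxE.
have Afg : finitely_generated (submodule W).
  exists 1, (fun=> Submodule xW) => -[y yW]; have /asboolP[d yE] := yW.
  by exists (fun=> d); apply/val_inj; rewrite big_ord1.
have [g gP] := Qfpi _ _ (submodule W) Bfp Afg f.
have [d [dx fx]] := fP (Submodule xW).
(* Here [f x] is only known as d u for some d with d x = x; as 1 - d kills x, it kills u. *)
exists (g 1); have -> : u = d * u.
  apply/eqP; rewrite -subr_eq0 -{1}(mul1r u) -mulrBl; apply/eqP/ann.
  by rewrite mulrBl mul1r -dx subrr.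
rewrite -fx -gP /= -[x in LHS]mulr1.
exact: (linearZZ g x 1).
Qed.

Lemma no_descending_chain_wf (T : Type) (lt : T -> T -> Prop) :
  (forall x : nat -> T, ~ forall n, lt (x n.+1) (x n)) -> well_founded lt.
Proof.
move=> nchain x0; apply: contrapT => nx0.
have /choice[f fP] : forall x : {x | ~ Acc lt x}, exists y : {x | ~ Acc lt x},
    lt (sval y) (sval x).
  move=> [x nx]; apply: contrapT => H; apply: (nx); constructor=> y yx.
  by apply: contrapT => ny; apply: H; exists (exist _ y ny).
by apply: (nchain (fun n => sval (iter n f (exist _ x0 nx0)))) => n; exact: fP.
Qed.

Section FractionRing.
(* S behaves as the ring of fractions of R with denominators in D. *)
Variables (R S : comPzRingType) (phi : {rmorphism R -> S}) (D : mulrClosed R).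
Hypothesis D_regular : forall s x, s \in D -> s * x = 0 -> x = 0.
Hypothesis phi_inj : injective phi.
Hypothesis phi_den : forall q, exists2 s, s \in D & exists r, phi s * q = phi r.
Hypothesis phi_inv : forall s, s \in D -> exists q, phi s * q = 1.

Lemma common_den (I : finType) (P : I -> R -> Prop) :
  (forall i r s, r \in D -> P i s -> P i (r * s)) ->
  (forall i, exists2 s, s \in D & P i s) ->
  exists2 s, s \in D & forall i, P i s.
Proof.
move=> PM ex; have /choice[s sP] : forall i, exists s, s \in D /\ P i s.
  by move=> i; have [s] := ex i; exists s.
exists (\prod_i s i) => [|i]; first by apply: rpred_prod => i _; case: (sP i).
rewrite (bigD1 i) //= mulrC; apply: PM; last by case: (sP i).
by apply: rpred_prod => j _; case: (sP j).
Qed.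

Lemma flat_dual_family (M : lmodType R) n (x : 'I_n -> M) :
  perfect_ring S -> flat_module M -> dual_family x.
Proof.
move=> perfS flatM.
pose MS := extend phi M S^o; pose j : M -> MS := @extend_unit R S phi M.
have MSproj : projective_module MS := perfS _ (@flat_extend R S phi M flatM).
have [p [a [y [xE aP]]]] := projective_dual_family (fun i => j (x i)) MSproj.
have [s sD /choice[al alE]] : exists2 s, s \in D &
    forall ik : 'I_n * 'I_p, exists r, phi s * a ik.1 ik.2 = phi r.
  apply: common_den => [ik r s rD [t st]|ik]; last exact: phi_den.
  by exists (r * t); rewrite !rmorphM -mulrA st.
have [t tD /choice[mu muE]] : exists2 t, t \in D &
    forall k, exists m, phi t *: y k = j m.
  apply: common_den => [k r s' rD [m sm]|k]; last exact: extend_den phi_den _.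
  by exists (r *: m); rewrite rmorphM -scalerA sm [RHS]extend_unitZ.
have eqn i : (s * t) *: x i = \sum_k al (i, k) *: mu k.
  apply: (extend_unit_inj phi_inj flatM).
  rewrite extend_unitZ [extend_unit _ _]xE extend_unit_sum scaler_sumr.
  apply: eq_bigr => k _; rewrite extend_unitZ -[extend_unit _ _]muE -(alE (i, k)) !scalerA rmorphM.
  by congr (_ *: _); ring.
(* The x_i and mu_k are taken together as unknowns, so that flatness expresses both through common
   vectors z. *)
pose A i (v : 'I_n + 'I_p) :=
  match v with inl i' => (s * t) * (i' == i)%:R | inr k => - al (i, k) end.
pose w (v : 'I_n + 'I_p) := match v with inl i => x i | inr k => mu k end.
have Aw i : \sum_v A i v *: w v = 0.
  rewrite big_sumType /= (bigD1 i) //= eqxx mulr1 big1 ?addr0; last first.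
    by move=> i' /negbTE ->; rewrite mulr0 scale0r.
  rewrite eqn -big_split big1 // => k _ /=.
  by rewrite scaleNr subrr.
have [m [c [z [wz Ac]]]] := flat_equational flatM Aw.
exists m, (fun i => c (inl i)), z; split=> [i|r rx0 k]; first exact: (wz (inl i)).
have st_inj u : (s * t) * u = 0 -> u = 0.
  by rewrite -mulrA => /(D_regular sD)/(D_regular tD).
have cE i : (s * t) * c (inl i) k = \sum_l al (i, l) * c (inr l) k.
  have := Ac i k; rewrite big_sumType /= (bigD1 i) //= eqxx mulr1 big1 ?addr0.
    move=> /eqP; rewrite addr_eq0 => /eqP->; rewrite -sumrN.
    by apply: eq_bigr => l _; rewrite mulNr opprK.
  by move=> i' /negbTE ->; rewrite mulr0 mul0r.
(* A relation r among the x_i kills their coordinates over S, hence also the cleared coordinates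
   [al]. *)
have al0 l : \sum_i r i * al (i, l) = 0.
  apply: phi_inj; rewrite rmorph0 rmorph_sum.
  have sum0 : \sum_i phi (r i) *: j (x i) = 0.
    by under eq_bigr do rewrite -extend_unitZ; rewrite -extend_unit_sum rx0 extend_unit0.
  have := aP _ sum0 l => /(congr1 ( *%R (phi s))).
  rewrite mulr0 mulr_sumr => sumE; rewrite -[RHS]sumE; apply: eq_bigr => i _.
  by rewrite rmorphM -(alE (i, l)) /=; ring.
(* By [cE], s t times the sum is a combination of the sums in [al0]. *)
apply: st_inj; rewrite mulr_sumr.
under eq_bigr do rewrite mulrCA cE mulr_sumr.
rewrite exchange_big big1 // => l _ /=.
under eq_bigr do rewrite mulrA.
by rewrite -mulr_suml al0 mul0r.
Qed.

Lemma flat_finitely_projective_dcc :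
  fp_injective S^o ->
  (forall M : lmodType R, flat_module M -> finitely_projective M) ->
  principal_dcc S.
Proof.
move=> Sfpi flatfp; apply: no_descending_chain_wf => x xlt.
have /choice[c xc] n : exists c, x n.+1 = x n * c by case: (xlt n).
(* The factors are x 0 and then the successive quotients, so x n is a product of n + 1 of them. *)
pose d n := if n is m.+1 then c m else x 0.
have xE n : x n = \prod_(0 <= i < n.+1) d i.
  elim: n => [|n IH]; first by rewrite big_nat1.
  by rewrite big_nat_recr //= -IH xc.
have /choice[s sP] n : exists s, s \in D /\
    exists r, phi s * d n = phi r.
  by have [s sD sr] := phi_den (d n); exists s.
have /choice[a aE] n : exists r, phi (s n) * d n = phi r by case: (sP n).
have prodE n : phi (\prod_(0 <= i < n) a i) =
    phi (\prod_(0 <= i < n) s i) * \prod_(0 <= i < n) d i.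
  rewrite !rmorph_prod -big_split; apply: eq_bigr => i _.
  by rewrite /= -aE.
have [l [p [u [v [lE uP]]]]] := bass_chain (flatfp _ (@flat_bass R a)).
(* An element of S killing the product kills u k, by passing to a numerator in R; FP-injectivity
   turns this into divisibility. *)
have udvd m k : exists b, phi (u k) = phi (\prod_(0 <= i < m) a i) * b.
  apply: fp_injective_annihilator => // q qa0.
  have [t tD [r tq]] := phi_den q.
  have [t' tt'] := phi_inv tD.
  have ru0 : r * u k = 0.
    apply: (uP m); apply: phi_inj.
    by rewrite rmorphM -tq -mulrA [q * _]qa0 mulr0 rmorph0.
  rewrite -(mul1r q) -tt'.
  transitivity (t' * (phi t * q * phi (u k))); first by ring.
  by rewrite [phi t * q]tq -rmorphM ru0 rmorph0 mulr0.
(* Products of l + 1 and l + 2 factors belong to [x l] and [x l.+1]; dividing the u k by the longer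
   one makes [x l] a multiple of [x l.+1]. *)
have /choice[b bE] := udvd l.+2.
have [t tt] : exists t, phi (\prod_(0 <= i < l.+1) s i) * t = 1.
  by apply: phi_inv; apply: rpred_prod => i _; case: (sP i).
case: (xlt l) => _; apply.
exists (t * phi (\prod_(0 <= i < l.+2) s i) * phi (a l) * \sum_k b k * phi (v k)).
have E : phi (\prod_(0 <= i < l.+1) a i) =
    phi (a l) * (phi (\prod_(0 <= i < l.+2) a i) * \sum_k b k * phi (v k)).
  rewrite big_nat_recr //= lE rmorphM mulrC; congr (_ * _).
  rewrite rmorph_sum mulr_sumr; apply: eq_bigr => k _.
  by rewrite rmorphM bE mulrA.
transitivity (t * phi (\prod_(0 <= i < l.+1) a i)).
  by rewrite prodE -xE mulrA [t * _]mulrC tt mul1r.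
by rewrite E [in LHS]prodE -xE; ring.
Qed.

End FractionRing.

(** * The total quotient ring as a ring of fractions *)

Section TotalQuotient.
Variable R : comPzRingType.

Local Notation Q := (total_quotient R).
Local Notation D := (@non_zero_divisor R).

Definition to_quotient (r : R) : Q := loc_frac r (loc_den1 D).

Lemma to_quotientB : {morph to_quotient : r s / r - s}.
Proof.
move=> r s; rewrite -[RHS]/(loc_add (to_quotient r) (loc_opp (to_quotient s))).
by rewrite loc_oppE loc_addE; apply: loc_frac_congr; rewrite /= !mulr1.
Qed.

Lemma to_quotientM : {morph to_quotient : r s / r * s}.
Proof.
move=> r s; rewrite -[RHS]/(loc_mul (to_quotient r) (to_quotient s)).
by rewrite loc_mulE; apply: loc_frac_congr; rewrite /= !mulr1.
Qed.

HB.instance Definition _ := GRing.isZmodMorphism.Build R Q to_quotient to_quotientB.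
HB.instance Definition _ :=
  GRing.isMonoidMorphism.Build R Q to_quotient (conj (erefl _) to_quotientM).

Lemma to_quotient_inj : injective to_quotient.
Proof.
move=> r s /eq_loc_frac[u /asboolP uD]; rewrite /= !mulr1 => urs.
by apply/eqP; rewrite -subr_eq0; apply/eqP/uD; rewrite mulrBr urs subrr.
Qed.

Lemma to_quotient_den (q : Q) : exists2 s, s \in D & exists r, to_quotient s * q = to_quotient r.
Proof.
have [r [[s sD] ->]] := loc_fracP q; exists s => //; exists r.
rewrite -[LHS]/(loc_mul _ _) loc_mulE; apply: loc_frac_congr.
by rewrite /= mul1r mulr1 mulrC.
Qed.

Lemma to_quotient_inv s : s \in D -> exists q, to_quotient s * q = 1.
Proof.
move=> sD; exists (loc_frac 1 (exist _ s sD)).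
rewrite -[LHS]/(loc_mul _ _) -[RHS]/(to_quotient 1) loc_mulE; apply: loc_frac_congr.
by rewrite /= !mulr1 !mul1r.
Qed.

End TotalQuotient.

Theorem theorem1p8 (R : comPzRingType) :
  fp_injective (total_quotient R)^o ->
  ((forall M : lmodType R, flat_module M -> finitely_projective M) <->
   perfect_ring (total_quotient R)).
Proof.
move=> Qfpi.
have regular (s x : R) : s \in @non_zero_divisor R -> s * x = 0 -> x = 0.
  by move=> /asboolP; exact.
split=> [flatfp|perfQ M flatM].
  apply: principal_dcc_perfect.
  exact: (@flat_finitely_projective_dcc R (total_quotient R) (@to_quotient R)
    (@non_zero_divisor R) (@to_quotient_inj R) (@to_quotient_den R)
    (@to_quotient_inv R) Qfpi flatfp).
apply: dual_family_finitely_projective => n x.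
exact: (@flat_dual_family R (total_quotient R) (@to_quotient R)
  (@non_zero_divisor R) regular (@to_quotient_inj R) (@to_quotient_den R) M n x perfQ flatM).
Qed.
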